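(* Assume that $m:=\mathbb{E}\xi<\infty$. Then, for fixed $j\in\mathbb{N}$, $$\lim_{t\to\infty}\frac{N_j(t)}{t^j}=\frac{1}{m^j\,j!}\quad\text{a.s.}$$
   Context: Let $(\xi_i,\eta_i)_{i\in\mathbb{N}}$ be independent copies of a random vector $(\xi,\eta)$ whose components are a.s. positive and arbitrarily dependent. Put $S_0:=0$, $S_i:=\xi_1+\cdots+\xi_i$ and $T_i:=S_{i-1}+\eta_i$ for $i\in\mathbb{N}$; the sequence $T:=(T_i)_{i\in\mathbb{N}}$ is called a perturbed random walk. General branching process generated by $T$: at time $0$ there is one individual, the ancestor, whose children (the first generation) have birth times given by the points of $T$. The individuals of the $(j-1)$th generation produce the $j$th generation: the shifts of the birth times of the children of an individual with respect to that individual's birth time are distributed as a copy of $T$, the copies for different mothers being independent of each other and of the past. Formally, let $T^{(u)}=(T^{(u)}_i)_{i\in\mathbb{N}}$, $u\in\bigcup_{n\ge 0}\mathbb{N}^n$, be independent copies of $T$; the $j$th generation individual $u=(u_1,\ldots,u_j)\in\mathbb{N}^j$ has birth time $\sum_{i=1}^j T^{((u_1,\ldots,u_{i-1}))}_{u_i}$. For $j\in\mathbb{N}$ and $t\ge 0$, $N_j(t)$ denotes the number of $j$th generation individuals with birth times $\le t$. *)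

(* Defs.v *)
From HB Require Import structures.
From mathcomp Require Import all_boot all_order all_algebra.
From mathcomp Require Import all_classical all_reals all_analysis.

Set Implicit Arguments.
Unset Strict Implicit.
Unset Printing Implicit Defensive.
Import Order.TTheory GRing.Theory Num.Theory.
Import numFieldNormedType.Exports.

Local Open Scope classical_set_scope.
Local Open Scope ring_scope.

Section IndependentCopies.
Context (d d' : measure_display) (Omega : measurableType d)
  (E : measurableType d') (R : realType) (P : probability Omega R).

Definition mutually_independent (I : choiceType) (X : I -> Omega -> E) : Prop :=
  forall (J : seq I) (A : I -> set E), uniq J ->
    (forall i, i \in J -> measurable (A i)) ->
    P (\bigcap_(i in [set` J]) (X i @^-1` A i)) =
    (\prod_(i <- J) P (X i @^-1` A i))%E.

(* Laws are compared on measurable sets only: equality of the set functions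
   [pushforward P X] would also constrain non-measurable sets. *)
Definition same_law (X Y : Omega -> E) : Prop :=
  forall A : set E, measurable A -> P (X @^-1` A) = P (Y @^-1` A).

Definition independent_copies (I : choiceType) (X : I -> Omega -> E)
    (Y : Omega -> E) : Prop :=
  [/\ forall i, measurable_fun setT (X i),
      mutually_independent X
    & forall i, same_law (X i) Y].

End IndependentCopies.

(* Real sequences with the product sigma-algebra. *)
Definition cylinders (R : realType) : set (set (nat -> R)) :=
  [set C | exists (i : nat) (B : set R),
     measurable B /\ C = [set x | B (x i)]].

Notation sequence_space R := (g_sigma_algebraType (@cylinders R)).

(* Indices start at 0: [xi i], [eta i] and the [i]-th coordinate of the result
   stand for xi_(i+1), eta_(i+1) and T_(i+1) = S_i + eta_(i+1). *)
Definition perturbed_random_walk (Omega : Type) (R : realType)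
    (xi eta : nat -> Omega -> R) : Omega -> sequence_space R :=
  fun w i => \sum_(k < i) xi k w + eta i w.

Section BranchingProcess.
Context (Omega : Type) (R : realType).

(* Individuals are finite words over nat; [T u] is the sequence of birth times
   of the children of [u] relative to the birth time of [u]. *)
Variable T : seq nat -> Omega -> sequence_space R.

Definition birth_time (u : seq nat) (w : Omega) : R :=
  \sum_(i < size u) T (take i u) w (nth 0%N u i).

(* Extended-real valued: on an exceptional event a generation may have
   infinitely many births before time t. *)
Definition generation_count (j : nat) (t : R) (w : Omega) : \bar R :=
  counting [set u : j.-tuple nat | birth_time u w <= t].

End BranchingProcess.

(* Main.v *)
Require Import Defs.
From HB Require Import structures.
From mathcomp Require Import all_boot all_order all_algebra.
From mathcomp Require Import finmap.
From mathcomp Require Import all_classical all_reals all_analysis.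
From mathcomp Require Import measurable_realfun ring lra zify.
Import Order.TTheory GRing.Theory Num.Theory.
Import numFieldNormedType.Exports.

(** The idea is an induction on the generation that uses no more than the law of
    large numbers.

    A child of the ancestor with index [i] is born about time [m * i], and its
    descendants of order [p] form an independent copy of the [p]th generation.
    If the [p]th generation grows like [(t / m) ^ p / p!], the next one is
    therefore about the sum over [i <= t / m] of [((t - m * i) / m) ^ p / p!],
    which is [(t / m) ^ p.+1 / p.+1!]. The induction starts with [p = 0], where
    the count is 1, so the renewal theorem for the first generation is its
    first step. To make it rigorous, time is measured in units [mu] slightly
    smaller (upper bound) or larger (lower bound) than [m], and powers are
    replaced by the binomials ['C(n + p, p)], which are stable under partial
    sums and turn every additive error into a shift of [n]
    ([binomial_average_le], [binomial_average_ge]).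

    For the lower bound ([lower_bound]) it suffices that most children are not
    late and that, for a suitable common waiting time, most of them have a
    subtree that already obeys the bound: frequencies of iid events. For the
    upper bound ([upper_bound]) the exceptional children must be shown to
    contribute little, which needs a variable with finite mean that dominates
    the normalised counts at all times simultaneously. It is provided by an
    exponential functional of the tree: a word [u] of length [p] born before [t]
    either has a sum of letters [|u|] of order [t], and there are polynomially
    many of those, or is born before [kappa * |u|], and these early words are
    counted by [envelope], the sum of [expR (kappa * |u| - S u)], where [S u] is
    the birth time. Its mean is a product of convergent geometric series because
    the Laplace transform of the walk decays geometrically ([gcount_le_envelope],
    [envelope_integrable]).

    The probabilistic input is a one-sided strong law for pairwise independent
    nonnegative variables with finite mean, proved by Etemadi's truncation
    ([strong_law_upper]); it gives the position of the children
    ([perturbed_walk_linear_lower], [perturbed_walk_rarely_late]) and the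
    averages over their subtrees. That the subtrees are independent, distributed
    as the whole tree, and independent of the root follows from uniqueness of
    measures on cylinders ([subprocess_same_law], [subprocess_indep]). *)

Set Implicit Arguments.
Unset Strict Implicit.
Unset Printing Implicit Defensive.

Local Open Scope classical_set_scope.
Local Open Scope ring_scope.

(** * Random elements, independence and subfamilies *)

Lemma measurable_fun_EFin d (T : measurableType d) (R : realType) (D : set T)
    (f : T -> R) : measurable_fun D f -> measurable_fun D (fun x => (f x)%:E).
Proof. by move=> mf; exact/measurable_EFinP. Qed.

Section Independence.
Context (d : measure_display) (Omega : measurableType d) (R : realType)
  (P : probability Omega R).
Local Open Scope ereal_scope.

Definition indep d1 d2 (E1 : measurableType d1) (E2 : measurableType d2)
    (X : Omega -> E1) (Y : Omega -> E2) : Prop :=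
  forall A B, measurable A -> measurable B ->
    P (X @^-1` A `&` Y @^-1` B) = P (X @^-1` A) * P (Y @^-1` B).

Lemma measurable_preimage d1 (E1 : measurableType d1) (X : Omega -> E1) A :
  measurable_fun setT X -> measurable A -> measurable (X @^-1` A).
Proof. by move=> mX mA; rewrite -[_ @^-1` _]setTI; exact: mX. Qed.

Lemma same_law_integral d1 (E1 : measurableType d1) (X Y : Omega -> E1)
    (f : E1 -> \bar R) :
  measurable_fun setT X -> measurable_fun setT Y -> same_law P X Y ->
  measurable_fun setT f -> (forall x, 0 <= f x) ->
  \int[P]_w f (X w) = \int[P]_w f (Y w).
Proof.
move=> mX mY XY mf f0.
have := @ge0_integral_pushforward _ _ _ _ _ _ mX P setT f measurableT mf
  (fun x _ => f0 x).
have := @ge0_integral_pushforward _ _ _ _ _ _ mY P setT f measurableT mf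
  (fun x _ => f0 x).
rewrite !preimage_setT => <- <-.
by apply: eq_measure_integral => A mA _; exact: XY.
Qed.

Lemma same_law_ae d1 (E1 : measurableType d1) (X Y : Omega -> E1) (A : set E1) :
  measurable_fun setT X -> measurable_fun setT Y -> same_law P X Y ->
  measurable A -> {ae P, forall w, A (X w)} -> {ae P, forall w, A (Y w)}.
Proof.
move=> mX mY XY mA /negligibleP h.
have mXA : measurable (~` [set w | A (X w)]).
  by apply: measurableC; exact: measurable_preimage.
apply/negligibleP; first by apply: measurableC; exact: measurable_preimage.
rewrite -(h mXA).
by apply/esym; exact: (XY (~` A) (measurableC mA)).
Qed.

(** The joint law of independent elements is the product of their laws, so
    Tonelli's theorem separates the two factors. *)
Lemma integral_indep d1 d2 (E1 : measurableType d1) (E2 : measurableType d2)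
    (X : Omega -> E1) (Y : Omega -> E2) (f : E1 -> \bar R) (g : E2 -> \bar R) :
  measurable_fun setT X -> measurable_fun setT Y -> indep X Y ->
  measurable_fun setT f -> (forall x, 0 <= f x) ->
  measurable_fun setT g -> (forall x, 0 <= g x) ->
  \int[P]_w (f (X w) * g (Y w)) = \int[P]_w f (X w) * \int[P]_w g (Y w).
Proof.
move=> mX mY XY mf f0 mg g0.
pose X' : {mfun Omega >-> E1} := HB.pack X (isMeasurableFun.Build _ _ _ _ _ mX).
pose Y' : {mfun Omega >-> E2} := HB.pack Y (isMeasurableFun.Build _ _ _ _ _ mY).
have mXY : measurable_fun setT (fun w => (X w, Y w)).
  exact: measurable_fun_pair.
pose h (z : E1 * E2) := f z.1 * g z.2.
have mh : measurable_fun setT h.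
  apply: emeasurable_funM; first by apply: measurableT_comp.
  by apply: measurableT_comp.
have h0 z : 0 <= h z by rewrite mule_ge0.
have := @ge0_integral_pushforward _ _ _ _ _ _ mXY P setT h measurableT mh
  (fun x _ => h0 x).
rewrite preimage_setT => <-.
transitivity (\int[distribution P X' \x distribution P Y']_z h z).
  apply/esym/eq_measure_integral => A mA _.
  by apply: product_measure_unique => // B C mB mC; exact: XY.
rewrite fubini_tonelli1//=.
under eq_integral do rewrite /fubini_F/= /h/= ge0_integralZl//.
rewrite ge0_integralZr//; last exact: integral_ge0.
congr (_ * _).
  have := @ge0_integral_pushforward _ _ _ _ _ _ mX P setT f measurableT mf
    (fun x _ => f0 x).
  by rewrite preimage_setT.
have := @ge0_integral_pushforward _ _ _ _ _ _ mY P setT g measurableT mg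
  (fun x _ => g0 x).
by rewrite preimage_setT.
Qed.

Section GeneratedUniqueness.
Context (d1 : measure_display) (E1 : measurableType d1).
Variable G : set (set E1).
Hypothesis mG : @measurable _ E1 = <<s G >>.
Hypothesis GI : setI_closed G.
Hypothesis GT : G setT.

Lemma same_law_generated (X Y : Omega -> E1) :
  measurable_fun setT X -> measurable_fun setT Y ->
  (forall A, G A -> P (X @^-1` A) = P (Y @^-1` A)) -> same_law P X Y.
Proof.
move=> mX mY GXY A mA.
pose X' : {mfun Omega >-> E1} := HB.pack X (isMeasurableFun.Build _ _ _ _ _ mX).
pose Y' : {mfun Omega >-> E1} := HB.pack Y (isMeasurableFun.Build _ _ _ _ _ mY).
apply: (@measure_unique _ _ _ G (fun=> setT) _ _ _ _
  (distribution P X') (distribution P Y')) => //.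
- by rewrite bigcup_const.
- by move=> _; rewrite ltey_eq fin_num_measure.
Qed.

(** For a fixed event [B], both sides are finite measures in [A] that agree on
    a generating pi-system. *)
Lemma indep_event_generated (X : Omega -> E1) (B : set Omega) :
  measurable_fun setT X -> measurable B ->
  (forall A, G A -> P (X @^-1` A `&` B) = P (X @^-1` A) * P B) ->
  forall A, measurable A -> P (X @^-1` A `&` B) = P (X @^-1` A) * P B.
Proof.
move=> mX mB GX A mA.
pose X' : {mfun Omega >-> E1} := HB.pack X (isMeasurableFun.Build _ _ _ _ _ mX).
have PBf : P B \is a fin_num by exact: fin_num_measure.
have fB0 : (0 <= fine (P B))%R by apply: fine_ge0.
pose k : {nonneg R} := NngNum fB0.
have mscaleE S : measurable S -> mscale k (distribution P X') S = P (X @^-1` S) * P B.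
  by move=> mS; rewrite /mscale/= fineK// muleC.
rewrite -mscaleE//.
have := @measure_unique _ _ _ G (fun=> setT) _ _ _ _
  (pushforward (mrestr P mB) X') (mscale k (distribution P X')).
apply => //.
- by rewrite bigcup_const.
- move=> S GS; apply: etrans (GX S GS) _; apply/esym/mscaleE.
  by rewrite mG; exact: sub_sigma_algebra.
- by move=> _; change (P (setT `&` B) < +oo); rewrite setTI -ge0_fin_numE.
Qed.

End GeneratedUniqueness.

(** The product rule is extended from the generators one argument at a time. *)
Lemma indep_generated d1 d2 (E1 : measurableType d1) (E2 : measurableType d2)
    (G1 : set (set E1)) (G2 : set (set E2)) (X : Omega -> E1) (Y : Omega -> E2) :
  @measurable _ E1 = <<s G1 >> -> setI_closed G1 -> G1 setT ->
  @measurable _ E2 = <<s G2 >> -> setI_closed G2 -> G2 setT ->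
  measurable_fun setT X -> measurable_fun setT Y ->
  (forall A B, G1 A -> G2 B ->
    P (X @^-1` A `&` Y @^-1` B) = P (X @^-1` A) * P (Y @^-1` B)) ->
  indep X Y.
Proof.
move=> e1 I1 T1 e2 I2 T2 mX mY XY A B mA mB.
apply: (indep_event_generated e1 I1 T1) => //; first exact: measurable_preimage.
move=> A' GA'; rewrite setIC muleC.
have mA' : measurable A' by rewrite e1; exact: sub_sigma_algebra.
apply: (indep_event_generated e2 I2 T2) => //; first exact: measurable_preimage.
by move=> B' GB'; rewrite setIC muleC; exact: XY.
Qed.

End Independence.

(** Cylinders constrain finitely many coordinates, rather than one, so that they
    form a pi-system generating the product sigma-algebra; the results above
    then apply to families of random elements. *)
Definition fin_cylinders (I : choiceType) d (E : measurableType d) :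
    set (set (I -> E)) :=
  [set C | exists (J : seq I) (A : I -> set E),
     [/\ uniq J, forall i, i \in J -> measurable (A i)
       & C = \bigcap_(i in [set` J]) [set x | A i (x i)]]].

Notation process_space I E := (g_sigma_algebraType (@fin_cylinders I _ E)).

Section ProcessSpace.
Context (I : choiceType) (d : measure_display) (E : measurableType d).

Lemma fin_cylindersI : setI_closed (@fin_cylinders I _ E).
Proof.
move=> _ _ [J1 [A1 [u1 m1 ->]]] [J2 [A2 [u2 m2 ->]]].
exists (undup (J1 ++ J2)),
  (fun i => (if i \in J1 then A1 i else setT) `&`
            (if i \in J2 then A2 i else setT)).
split; first exact: undup_uniq.
  move=> i _; apply: measurableI; case: ifPn => // h; first exact: m1.
  exact: m2.
apply/seteqP; split => [x [h1 h2] i /= _|x h].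
  by split; case: ifPn => // h; [exact: h1|exact: h2].
split => i /= iJ.
  by have := h i; rewrite /= mem_undup mem_cat iJ => /(_ isT)[].
by have := h i; rewrite /= mem_undup mem_cat iJ orbT => /(_ isT)[_].
Qed.

Lemma fin_cylindersT : @fin_cylinders I _ E setT.
Proof.
exists [::], (fun=> setT); split => //.
by apply/seteqP; split.
Qed.

Lemma measurable_process d' (Om : measurableType d') (X : Om -> process_space I E) :
  (forall i, measurable_fun setT (fun w => X w i)) -> measurable_fun setT X.
Proof.
move=> mX; apply: measurability; first by [].
move=> _ [_ [J [A [uJ mA ->]]] <-]; rewrite setTI preimage_bigcap.
apply: fin_bigcap_measurable; first exact: finite_seq.
move=> i iJ; rewrite [X in measurable X](_ : _ = (fun w => X w i) @^-1` A i)//.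
by apply: measurable_preimage => //; exact: mA.
Qed.

Lemma measurable_coord (i : I) :
  measurable_fun setT (fun x : process_space I E => x i).
Proof.
move=> _ A mA; rewrite setTI; apply: sub_sigma_algebra.
exists [:: i], (fun=> A); split => //.
apply/seteqP; split => [x/= Ax j/=|x /(_ i) /=].
  by rewrite inE => /eqP ->.
by rewrite inE eqxx; exact.
Qed.

End ProcessSpace.

Section IndependentProcesses.
Context (d : measure_display) (Omega : measurableType d) (R : realType)
  (P : probability Omega R) (I : choiceType) (d' : measure_display)
  (E : measurableType d') (X : I -> Omega -> E) (Y : Omega -> E).
Hypothesis XY : independent_copies P X Y.
Local Open Scope ereal_scope.

Let process (J : choiceType) (phi : J -> I) : Omega -> process_space J E :=
  fun w j => X (phi j) w.

Lemma measurable_subprocess (J : choiceType) (phi : J -> I) :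
  measurable_fun setT (process phi).
Proof. by case: XY => mX _ _; apply: measurable_process => j; exact: mX. Qed.

Let process_cylinder (J : choiceType) (phi : J -> I) (L : seq J)
    (A : J -> set E) (g : I -> J) : cancel phi g ->
  process phi @^-1` (\bigcap_(j in [set` L]) [set x | A j (x j)]) =
  \bigcap_(i in [set` map phi L]) (X i @^-1` (A (g i))).
Proof.
move=> gK; apply/seteqP; split => w /= h.
  by move=> _ /= /mapP[j jL ->]; rewrite /= gK; exact: h.
move=> j /= jL; have := h (phi j); rewrite /= gK; apply.
exact: map_f.
Qed.

Let left_inverse (J : choiceType) (phi : J -> I) : injective phi -> J ->
  exists g : I -> J, cancel phi g.
Proof.
move=> phiI j0.
exists (fun i => xget j0 [set j | phi j = i]) => j.
by case: xgetP => [j' _ /= /phiI//|/(_ j) /=].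
Qed.

(** The right-hand side does not mention [phi]: this is why all subfamilies
    indexed by the same set have the same law. *)
Lemma probability_cylinder (J : choiceType) (phi : J -> I) (L : seq J)
    (A : J -> set E) :
  injective phi -> uniq L -> (forall j, j \in L -> measurable (A j)) ->
  P (process phi @^-1` (\bigcap_(j in [set` L]) [set x | A j (x j)])) =
  \prod_(j <- L) P (Y @^-1` A j).
Proof.
move=> phiI uL mA; case: XY => mX iX lX.
case: L uL mA => [|j0 L] uL mA.
  rewrite big_nil [X in P X](_ : _ = setT) ?probability_setT//.
  by apply/seteqP; split.
have [g gK] := left_inverse phiI j0.
rewrite (process_cylinder _ _ gK) iX.
- rewrite big_map; apply: eq_big_seq => j jL; rewrite gK.
  by apply: lX; exact: mA.
- by rewrite map_inj_uniq.
- by move=> _ /mapP[j jL ->]; rewrite gK; exact: mA.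
Qed.

Lemma subprocess_same_law (J : choiceType) (phi psi : J -> I) :
  injective phi -> injective psi -> same_law P (process phi) (process psi).
Proof.
move=> phiI psiI; apply: (@same_law_generated _ _ _ _ _ (process_space J E)
  (@fin_cylinders J _ E)) => //.
- exact: fin_cylindersI.
- exact: fin_cylindersT.
- exact: measurable_subprocess.
- exact: measurable_subprocess.
- by move=> _ [L [A [uL mA ->]]]; rewrite !probability_cylinder.
Qed.

(** A cylinder over [J] and one over [K] form together a single cylinder for the
    injection of [J + K] given by [phi] and [psi], whose probability is a
    product. *)
Lemma subprocess_indep (J K : choiceType) (phi : J -> I) (psi : K -> I) :
  injective phi -> injective psi -> (forall j k, phi j <> psi k) ->
  indep P (process phi) (process psi).
Proof.
move=> phiI psiI phipsi.
apply: (@indep_generated _ _ _ _ _ _ (process_space J E) (process_space K E)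
  (@fin_cylinders J _ E) (@fin_cylinders K _ E)) => //.
- exact: fin_cylindersI.
- exact: fin_cylindersT.
- exact: fin_cylindersI.
- exact: fin_cylindersT.
- exact: measurable_subprocess.
- exact: measurable_subprocess.
move=> _ _ [L [A [uL mA ->]]] [M [B [uM mB ->]]].
rewrite !probability_cylinder//.
pose h (s : J + K) := match s with inl j => phi j | inr k => psi k end.
have hI : injective h.
  move=> [j|k] [j'|k'] //= e; first by rewrite (phiI _ _ e).
  - by case: (phipsi j k').
  - by case: (phipsi j' k).
  - by rewrite (psiI _ _ e).
pose C (s : J + K) := match s with inl j => A j | inr k => B k end.
have := @probability_cylinder _ h (map inl L ++ map inr M) C hI.
rewrite big_cat !big_map/= => <-.
- congr (P _); apply/seteqP; split => w.
    move=> [/= h1 h2] [j|k] /=; rewrite mem_cat => /orP[] /mapP[] //.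
    + by move=> j' j'L [->]; exact: h1.
    + by move=> k' k'L [->]; exact: h2.
  move=> /= hw; split => [j jL|k kM].
    by apply: (hw (inl j)); rewrite /= mem_cat map_f.
  by apply: (hw (inr k)); rewrite /= mem_cat map_f// orbT.
- rewrite cat_uniq !map_inj_uniq ?uL ?uM//; try by move=> ? ? [].
  rewrite andbT /=; apply/hasPn => _ /mapP[k _ ->].
  by apply/negP => /mapP[].
- move=> [j|k] /=; rewrite mem_cat => /orP[] /mapP[] //.
    by move=> j' j'L [->]; exact: mA.
  by move=> k' k'L [->]; exact: mB.
Qed.

End IndependentProcesses.

(** * Truncation and the strong law of large numbers *)

Section TruncatedSecondMoment.
Context (R : realType).
Implicit Types (q x : R).

(** The term of index [k] is [q ^+ k] as long as [q ^+ k <= x], and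
    [x ^+ 2 / q ^+ k] afterwards: two geometric sums, each dominated by its terms
    with [q ^+ k] close to [x]. *)
Lemma truncated_square_geometric_sum q x : 1 < q -> 0 <= x -> forall K,
  \sum_(k < K) (Order.min x (q ^+ k)) ^+ 2 / q ^+ k <= 2 * q / (q - 1) * x.
Proof.
move=> q1 x0 K.
have r0 : 0 < q - 1 by rewrite subr_gt0.
have q0 : 0 < q by apply: lt_trans q1.
(* the closed form of the sum, on either side of the crossover, is inductive *)
suff H : (q - 1) * (\sum_(k < K) (Order.min x (q ^+ k)) ^+ 2 / q ^+ k) <=
    if q ^+ K <= x then q ^+ K else 2 * q * x - x ^+ 2 * q / q ^+ K.
  rewrite mulrAC ler_pdivlMr// mulrC; apply: le_trans H _.
  case: ifPn => [h|_].
    by apply: (le_trans h); rewrite mulrC ler_peMr//; lra.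
  by rewrite gerBl divr_ge0// ?mulr_ge0 ?sqr_ge0 ?exprn_ge0// ltW.
elim: K => [|K IH].
  rewrite big_ord0 mulr0 expr0; case: ifPn => //; rewrite -ltNge => h.
  have : 0 <= q * x * (2 - x) by rewrite mulr_ge0 ?mulr_ge0 ?(ltW q0)//; lra.
  by rewrite divr1; nra.
rewrite big_ord_recr/= mulrDr; apply: (le_trans (lerD IH (lexx _))).
set a := q ^+ K; have a0 : 0 < a by rewrite exprn_gt0.
have -> : q ^+ K.+1 = q * a by rewrite exprS.
case: ifPn => ax.
  rewrite min_r// expr2 mulfK ?gt_eqF//.
  have -> : a + (q - 1) * a = q * a by ring.
  case: ifPn => // ; rewrite -ltNge => xqa.
  rewrite lerBrDr -lerBrDl ler_pdivrMr ?mulr_gt0//.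
  have : 0 <= (q * a - x) * (x - a) by rewrite mulr_ge0// subr_ge0// ltW.
  by nra.
rewrite -ltNge in ax; rewrite min_l ?(ltW ax)//.
have xqa : x < q * a by nra.
rewrite ifN -?ltNge// le_eqVlt; apply/orP; left; apply/eqP.
by field; rewrite !gt_eqF.
Qed.

(** Truncation acts on extended reals, [+oo] being sent to [a]: the strong law is
    applied below to a functional of the tree that may be infinite. *)
Definition truncate (a : R) (z : \bar R) : R := fine (Order.min z a%:E).

Lemma truncate_ge0 a z : 0 <= a -> (0 <= z)%E -> 0 <= truncate a z.
Proof. by move=> a0 z0; rewrite fine_ge0// le_min z0 lee_fin. Qed.

Lemma truncateE a z : (0 <= z)%E -> (truncate a z)%:E = Order.min z a%:E.
Proof.
case: z => [x _| _|//]; first by rewrite /truncate -EFin_min.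
by rewrite /truncate min_r ?leey.
Qed.

Lemma truncate_le a z : (0 <= z)%E -> ((truncate a z)%:E <= z)%E.
Proof. by move=> z0; rewrite truncateE// ge_min lexx. Qed.

Lemma truncate_id a z : (0 <= z)%E -> (z <= a%:E)%E -> (truncate a z)%:E = z.
Proof. by move=> z0 za; rewrite truncateE// min_l. Qed.

Lemma truncate_cst a z : (a%:E <= z)%E -> truncate a z = a.
Proof. by move=> za; rewrite /truncate min_r. Qed.

Lemma measurable_truncate a : measurable_fun setT (truncate a).
Proof.
apply: (@measurableT_comp _ _ _ _ _ _ fine); first exact: fine_measurable.
by apply: measurable_mine => //; exact: measurable_cst.
Qed.

Lemma truncated_square_geometric_series q (z : \bar R) : 1 < q -> (0 <= z)%E ->
  (\sum_(0 <= k <oo) ((truncate (q ^+ k) z) ^+ 2 / q ^+ k)%:E <=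
   (2 * q / (q - 1))%:E * z)%E.
Proof.
move=> q1 z0; have q0 : 0 < q by apply: lt_trans q1.
have C0 : 0 < 2 * q / (q - 1) by rewrite divr_gt0 ?mulr_gt0// subr_gt0.
apply: lime_le.
  apply: is_cvg_nneseries => k _ _.
  by rewrite lee_fin divr_ge0 ?sqr_ge0 ?exprn_ge0// ltW.
apply: nearW => K; rewrite sumEFin big_mkord.
case: z z0 => [x x0|_|//]; last by rewrite gt0_muley ?leey// lte_fin.
rewrite -EFinM lee_fin.
under eq_bigr do rewrite /truncate -EFin_min/=.
exact: truncated_square_geometric_sum.
Qed.

End TruncatedSecondMoment.

Section StrongLaw.
Context (d : measure_display) (Omega : measurableType d) (R : realType)
  (P : probability Omega R) (d' : measure_display) (E : measurableType d')
  (X : nat -> Omega -> E) (Y : Omega -> E).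
Hypothesis mX : forall i, measurable_fun setT (X i).
Hypothesis mY : measurable_fun setT Y.
Hypothesis XI : forall i j, i <> j -> indep P (X i) (X j).
Hypothesis XY : forall i, same_law P (X i) Y.

Section Chebyshev.
Variables (g : E -> R) (m : R).
Hypothesis mg : measurable_fun setT g.
Hypothesis g0 : forall x, 0 <= g x.
Hypothesis gm : (\int[P]_w (g (Y w))%:E)%E = m%:E.

Let S n w := \sum_(i < n) g (X i w).

Let mgX i : measurable_fun setT (fun w => g (X i w)).
Proof. exact: measurableT_comp. Qed.

Let mS n : measurable_fun setT (S n).
Proof. by apply: measurable_sum => i; exact: mgX. Qed.

Let S0 n w : 0 <= S n w.
Proof. by apply: sumr_ge0. Qed.

Let intgX i : (\int[P]_w (g (X i w))%:E)%E = m%:E.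
Proof.
rewrite -gm; apply: (@same_law_integral _ _ _ _ _ _ _ _ (fun x => (g x)%:E)) => //.
exact: measurable_fun_EFin.
Qed.

Let intgX2 i : (\int[P]_w ((g (X i w))^+2)%:E)%E = (\int[P]_w ((g (Y w))^+2)%:E)%E.
Proof.
apply: (@same_law_integral _ _ _ _ _ _ _ _ (fun x => ((g x)^+2)%:E)) => //.
  by apply: measurable_fun_EFin; exact: measurable_funX.
by move=> x; rewrite lee_fin sqr_ge0.
Qed.

Let intS n : (\int[P]_w (S n w)%:E)%E = (n%:R * m)%:E.
Proof.
under eq_integral do rewrite /S -sumEFin.
rewrite ge0_integral_sum//.
- under eq_bigr do rewrite intgX.
  by rewrite sumEFin sumr_const card_ord mulr_natl.
- by move=> i; apply: measurable_fun_EFin; exact: mgX.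
- by move=> i w _; rewrite lee_fin.
Qed.

Let intSg n : (\int[P]_w (S n w * g (X n w))%:E)%E = (n%:R * m ^+ 2)%:E.
Proof.
transitivity (\int[P]_w (\sum_(i < n) ((g (X i w))%:E * (g (X n w))%:E)))%E.
  apply: eq_integral => w _; rewrite /S big_distrl/= -sumEFin.
  by apply: eq_bigr => i _; rewrite EFinM.
rewrite ge0_integral_sum//.
- transitivity (\sum_(i < n) (m ^+ 2)%:E)%E; last first.
    by rewrite sumEFin sumr_const card_ord mulr_natl.
  apply: eq_bigr => i _.
  rewrite (@integral_indep _ _ _ _ _ _ _ _ _ _ (fun x => (g x)%:E)
    (fun x => (g x)%:E)).
  + by rewrite !intgX -EFinM expr2.
  + by [].
  + by [].
  + by apply: XI => e; have := ltn_ord i; rewrite e ltnn.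
  + exact: measurable_fun_EFin.
  + by move=> x; rewrite lee_fin.
  + exact: measurable_fun_EFin.
  + by move=> x; rewrite lee_fin.
- by move=> i; apply: emeasurable_funM; apply: measurable_fun_EFin; exact: mgX.
- by move=> i w _; rewrite -EFinM lee_fin mulr_ge0.
Qed.

Let intS2 n : (\int[P]_w ((S n w) ^+ 2)%:E <=
  n%:R%:E * \int[P]_w ((g (Y w))^+2)%:E + (n%:R ^+ 2 * m ^+ 2)%:E)%E.
Proof.
have V0 : (0 <= \int[P]_w ((g (Y w))^+2)%:E)%E.
  by apply: integral_ge0 => w _; rewrite lee_fin sqr_ge0.
elim: n => [|n IH].
  under eq_integral do rewrite /S big_ord0 expr0n/=.
  by rewrite integral0 adde_ge0 ?mule_ge0// lee_fin mulr_ge0// sqr_ge0.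
have mS2 : measurable_fun setT (fun w => ((S n w)^+2)%:E).
  by apply: measurable_fun_EFin; exact: measurable_funX.
have mSg : measurable_fun setT (fun w => (2%:E * (S n w * g (X n w))%:E)%E).
  by apply: measurable_funeM; apply: measurable_fun_EFin; exact: measurable_funM.
have mg2 : measurable_fun setT (fun w => ((g (X n w))^+2)%:E).
  by apply: measurable_fun_EFin; exact: measurable_funX.
have -> : (\int[P]_w (S n.+1 w ^+ 2)%:E = \int[P]_w ((((S n w)^+2)%:E +
    2%:E * (S n w * g (X n w))%:E) + ((g (X n w)) ^+ 2)%:E))%E.
  apply: eq_integral => w _.
  by rewrite -EFinM -!EFinD /S big_ord_recr/=; congr EFin; ring.
have Sg0 w : (0 <= (S n w * g (X n w))%:E)%E by rewrite lee_fin mulr_ge0.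
rewrite ge0_integralD//; last 3 first.
- by move=> w _; rewrite -EFinM -EFinD lee_fin addr_ge0 ?sqr_ge0// !mulr_ge0.
- exact: emeasurable_funD.
- by move=> w _; rewrite lee_fin sqr_ge0.
rewrite ge0_integralD//; last 2 first.
- by move=> w _; rewrite lee_fin sqr_ge0.
- by move=> w _; rewrite -EFinM lee_fin !mulr_ge0.
rewrite ge0_integralZl//; last first.
  by apply: measurable_fun_EFin; exact: measurable_funM.
rewrite intSg intgX2.
set V := (\int[P]_w ((g (Y w))^+2)%:E)%E in IH V0 *.
set W := (\int[P]_w ((S n w)^+2)%:E)%E in IH *.
have -> : (n.+1%:R%:E * V + (n.+1%:R ^+ 2 * m ^+ 2)%:E =
    n%:R%:E * V + (n.+1%:R ^+ 2 * m ^+ 2)%:E + V)%E.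
  by rewrite -natr1 EFinD ge0_muleDl ?lee_fin// mul1e addeAC.
rewrite leeD2r//; apply: (le_trans (leeD2r _ IH)).
rewrite -addeA leeD2l// -EFinM -EFinD lee_fin -natr1.
by have := sqr_ge0 m; nra.
Qed.

(** Pairwise independence bounds the second moment of the sum [S n] by
    [n * E g ^+ 2 + (n * m) ^+ 2]. The square of [S n - n * m] is expanded with
    [2 * (n * m) * S n] moved to the other side, which leaves only integrals of
    nonnegative functions. *)
Lemma upper_chebyshev n (c : R) : 0 < c ->
  ((c ^+ 2)%:E * P [set w | (n%:R * m + c <= S n w)%R] <=
   n%:R%:E * \int[P]_w ((g (Y w))^+2)%:E)%E.
Proof.
move=> c0.
have m0 : 0 <= m.
  rewrite -lee_fin -gm; apply: integral_ge0 => w _; rewrite lee_fin; exact: g0.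
pose D w := ((S n w - n%:R * m) ^+ 2)%:E.
have mD : measurable_fun setT D.
  apply: measurable_fun_EFin; apply/measurable_funX/measurable_funB => //.
have D0 w : (0 <= D w)%E by rewrite lee_fin sqr_ge0.
have main : (\int[P]_w D w <= n%:R%:E * \int[P]_w ((g (Y w))^+2)%:E)%E.
  have nm0 : 0 <= n%:R * m by rewrite mulr_ge0.
  have : (\int[P]_w (D w + (2 * (n%:R * m))%:E * (S n w)%:E) =
      \int[P]_w ((S n w ^+ 2)%:E + ((n%:R * m) ^+ 2)%:E))%E.
    apply: eq_integral => w _; rewrite /D -EFinM -!EFinD; congr EFin; ring.
  rewrite ge0_integralD//; last 2 first.
  - by move=> w _; rewrite -EFinM lee_fin !mulr_ge0.
  - by apply: measurable_funeM; exact: measurable_fun_EFin.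
  rewrite ge0_integralD//; last 3 first.
  - by move=> w _; rewrite lee_fin sqr_ge0.
  - by apply: measurable_fun_EFin; exact: measurable_funX.
  - by move=> w _; rewrite lee_fin sqr_ge0.
  rewrite integral_cst//= probability_setT mule1.
  rewrite ge0_integralZl//; last 3 first.
  - exact: measurable_fun_EFin.
  - by move=> w _; rewrite lee_fin.
  - by rewrite lee_fin !mulr_ge0.
  rewrite intS -EFinM => e.
  rewrite -(@leeD2rE _ (2 * (n%:R * m) * (n%:R * m))%:E)// e.
  apply: (le_trans (leeD2r _ (intS2 n))).
  rewrite -addeA leeD2l// -EFinD lee_fin.
  by rewrite le_eqVlt; apply/orP; left; apply/eqP; ring.
apply: le_trans main.
have := @le_integral_abse _ _ _ P setT measurableT D (c ^+ 2) mD.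
rewrite exprn_gt0// => /(_ isT).
under eq_integral do rewrite gee0_abs//.
apply: le_trans; rewrite lee_wpmul2l ?lee_fin ?sqr_ge0//.
apply: le_measure; rewrite ?inE.
- rewrite -[X in measurable X]setTI.
  by apply: measurable_fun_le => //; exact: mS.
- apply: emeasurable_fun_c_infty => //.
  by apply: measurableT_comp.
- move=> w /= h; split => //=; rewrite /D lee_fin ger0_norm ?sqr_ge0//.
  by rewrite ler_sqr ?nnegrE; lra.
Qed.

End Chebyshev.

Section Etemadi.
Variables (f : E -> \bar R) (alpha : R).
Hypothesis mf : measurable_fun setT f.
Hypothesis f0 : forall x, (0 <= f x)%E.
Hypothesis fa : (\int[P]_w f (Y w) < alpha%:E)%E.

Let e := fine (\int[P]_w f (Y w))%E.

Let int0 : (0 <= \int[P]_w f (Y w))%E.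
Proof. exact: integral_ge0. Qed.

Let eE : (\int[P]_w f (Y w))%E = e%:E.
Proof.
by rewrite /e fineK// ge0_fin_numE// (lt_trans fa)// ltry.
Qed.

Let e0 : 0 <= e. Proof. exact: fine_ge0. Qed.

Let ea : e < alpha. Proof. by rewrite -lte_fin -eE. Qed.

(* [beta] lies between the mean and [alpha]; the ratio [q] of the geometric
   times, with [beta * q = alpha], absorbs the gaps between these times. *)
Let beta := (e + alpha) / 2.
Let q := alpha / beta.
Let eps := beta - e.

Let beta0 : 0 < beta. Proof. by rewrite /beta; move: e0 ea => *; lra. Qed.
Let eps0 : 0 < eps. Proof. by rewrite /eps /beta; move: e0 ea => *; lra. Qed.
Let q1 : 1 < q.
Proof. by rewrite /q ltr_pdivlMr// mul1r /beta; move: e0 ea => *; lra. Qed.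
Let q0 : 0 < q. Proof. exact: lt_trans q1. Qed.
Let qX0 k : 0 < q ^+ k. Proof. by rewrite exprn_gt0. Qed.
Let qX0W k : 0 <= q ^+ k. Proof. exact: ltW. Qed.
Let betaq : beta * q = alpha.
Proof. by rewrite /q mulrC divfK// gt_eqF. Qed.

Let g k (x : E) := truncate (q ^+ k) (f x).

Let g0 k x : 0 <= g k x. Proof. exact: truncate_ge0. Qed.

Let gq k x : g k x <= q ^+ k.
Proof. by rewrite -lee_fin truncateE// ge_min lexx orbT. Qed.

Let mg k : measurable_fun setT (g k).
Proof. by apply: measurableT_comp => //; exact: measurable_truncate. Qed.

Let mgY k : measurable_fun setT (fun w => g k (Y w)).
Proof. exact: measurableT_comp. Qed.

Let mfY : measurable_fun setT (fun w => f (Y w)).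
Proof. exact: measurableT_comp. Qed.

Let m k := fine (\int[P]_w (g k (Y w))%:E)%E.

Let int_g_le k : (\int[P]_w (g k (Y w))%:E <= e%:E)%E.
Proof.
rewrite -eE; apply: ge0_le_integral => //.
- by move=> w _; rewrite lee_fin.
- exact: measurable_fun_EFin.
- by move=> w _; exact: truncate_le.
Qed.

Let int_g_ge0 k : (0 <= \int[P]_w (g k (Y w))%:E)%E.
Proof. by apply: integral_ge0 => w _; rewrite lee_fin. Qed.

Let mE k : (\int[P]_w (g k (Y w))%:E)%E = (m k)%:E.
Proof. by rewrite /m fineK// ge0_fin_numE// (le_lt_trans (int_g_le k))// ltry. Qed.

Let me k : m k <= e. Proof. by rewrite -lee_fin -mE. Qed.

Let v k := fine (\int[P]_w ((g k (Y w)) ^+ 2)%:E)%E.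

Let int_g2_ge0 k : (0 <= \int[P]_w ((g k (Y w)) ^+ 2)%:E)%E.
Proof. by apply: integral_ge0 => w _; rewrite lee_fin sqr_ge0. Qed.

Let mg2 k : measurable_fun setT (fun w => ((g k (Y w)) ^+ 2)%:E).
Proof. by apply: measurable_fun_EFin; exact: measurable_funX. Qed.

Let vE k : (\int[P]_w ((g k (Y w)) ^+ 2)%:E)%E = (v k)%:E.
Proof.
rewrite /v fineK// ge0_fin_numE//.
have : (\int[P]_w ((g k (Y w)) ^+ 2)%:E <= \int[P]_w (cst ((q ^+ k) ^+ 2)%:E w))%E.
  apply: ge0_le_integral => //.
  - by move=> w _; rewrite lee_fin sqr_ge0.
  - by move=> w _; rewrite lee_fin ler_sqr ?nnegrE.
move=> /le_lt_trans; apply.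
by rewrite integral_cst//= probability_setT mule1 ltry.
Qed.

Let v0 k : 0 <= v k. Proof. exact: fine_ge0. Qed.

Let N k := (Num.truncn (q ^+ k)).+1.

Let N_gt k : q ^+ k < (N k)%:R. Proof. exact: truncnS_gt. Qed.

Let N_le k : (N k)%:R <= q ^+ k + 1.
Proof. by rewrite /N -natr1 lerD2r truncn_le. Qed.

Let N0 k : 0 < (N k)%:R :> R. Proof. by rewrite ltr0n. Qed.

(* [A k] and [B k]: at time [N k] the truncated sum is too large, or the
   truncation is active *)
Let A k := [set w | (N k)%:R * m k + (N k)%:R * eps <= \sum_(i < N k) g k (X i w)].
Let B k i := [set w | ((q ^+ k)%:E <= f (X i w))%E].
Let F k := A k `|` \big[setU/set0]_(i < N k) B k i.

Let mA k : measurable (A k).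
Proof.
rewrite -[X in measurable X]setTI; apply: measurable_fun_le => //.
by apply: measurable_sum => i; exact: measurableT_comp.
Qed.

Let mB k i : measurable (B k i).
Proof.
rewrite -[X in measurable X]setTI; apply: emeasurable_fun_c_infty => //.
exact: measurableT_comp.
Qed.

Let mF k : measurable (F k).
Proof. by apply: measurableU => //; apply: bigsetU_measurable. Qed.

Let PA k : (P (A k) <= (eps ^- 2 * (v k / q ^+ k))%:E)%E.
Proof.
have := @upper_chebyshev (g k) (m k) (mg k) (@g0 k) (mE k) (N k) ((N k)%:R * eps)
  (mulr_gt0 (N0 k) eps0).
rewrite vE -/(A k) -(@fineK _ (P (A k))) ?fin_num_measure//.
rewrite -!EFinM !lee_fin; set a := fine _ => h.
have {}h : (N k)%:R * eps ^+ 2 * a <= v k.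
  rewrite -(@ler_pM2l _ (N k)%:R)//; apply: le_trans h.
  by rewrite le_eqVlt; apply/orP; left; apply/eqP; ring.
have a0 : 0 <= a by rewrite fine_ge0.
rewrite ler_pdivlMl ?exprn_gt0// ler_pdivlMr//; apply: le_trans h.
rewrite [leLHS]mulrC mulrA ler_wpM2r// ler_wpM2r ?sqr_ge0//.
exact/ltW/N_gt.
Qed.

Let PB k i : (P (B k i) <= (v k / (q ^+ k) ^+ 2)%:E)%E.
Proof.
pose h (x : E) := ((g k x) ^+ 2)%:E.
have h0 x : (0 <= h x)%E by rewrite lee_fin sqr_ge0.
have mh : measurable_fun setT h.
  by apply: measurable_fun_EFin; exact: measurable_funX.
have := @le_integral_abse _ _ _ P setT measurableT (h \o X i) ((q ^+ k) ^+ 2)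
  (measurableT_comp mh (mX i)).
rewrite exprn_gt0// => /(_ isT).
under eq_integral do rewrite gee0_abs ?h0//.
have -> : (\int[P]_x (h \o X i) x = (v k)%:E)%E.
  by rewrite -vE; exact: (same_law_integral (mX i) mY (XY i) mh h0).
rewrite -lee_pdivlMl ?exprn_gt0// -EFinM mulrC; apply: le_trans.
apply: le_measure; rewrite ?inE//.
- apply: emeasurable_fun_c_infty => //; apply: measurableT_comp => //.
  exact: measurableT_comp.
- move=> w /= hw; split => //=; rewrite /h lee_fin ger0_norm ?sqr_ge0//.
  by rewrite /g truncate_cst.
Qed.

Let PF k : (P (F k) <= ((eps ^- 2 + 2) * (v k / q ^+ k))%:E)%E.
Proof.
have mBU : measurable (\big[setU/set0]_(i < N k) B k i).
  by apply: bigsetU_measurable.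
apply: (le_trans (measureU2 _ (mA k) mBU)).
rewrite mulrDl EFinD leeD// ?PA//.
apply: (le_trans (Boole_inequality _ _)); first by move=> i _.
apply: (@le_trans _ _ (\sum_(i < N k) (v k / (q ^+ k) ^+ 2)%:E)%E).
  by apply: lee_sum => i _; exact: PB.
rewrite sumEFin lee_fin sumr_const card_ord -mulr_natl.
have NN : (N k)%:R <= 2 * q ^+ k.
  apply: (le_trans (N_le k)); have : 1 <= q ^+ k by rewrite exprn_ege1// ltW.
  by lra.
rewrite expr2 invfM mulrA mulrCA mulrA.
rewrite [leRHS](_ : _ = (2 * q ^+ k) * (v k / q ^+ k) / q ^+ k); last first.
  by field; rewrite gt_eqF.
rewrite [leLHS](_ : _ = (N k)%:R * (v k / q ^+ k) / q ^+ k); last first.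
  by field; rewrite gt_eqF.
rewrite ler_wpM2r ?invr_ge0// ler_wpM2r// divr_ge0//.
Qed.

(* Both events cost a multiple of [v k / q ^+ k], whose sum is bounded by the
   mean of [f] thanks to the geometric bound on truncated squares. *)
Let sumPF : (\sum_(0 <= k <oo) P (F k) < +oo)%E.
Proof.
set C1 := eps ^- 2 + 2.
have C10 : 0 <= C1 by rewrite addr_ge0// invr_ge0 sqr_ge0.
have h : (\sum_(0 <= k <oo) P (F k) <=
   \sum_(0 <= k <oo) C1%:E * (\int[P]_w ((g k (Y w)) ^+ 2 / q ^+ k)%:E))%E.
  apply: lee_nneseries => // k _; apply: (le_trans (PF k)).
  rewrite EFinM lee_wpmul2l ?lee_fin//.
  under eq_integral do rewrite mulrC EFinM.
  rewrite ge0_integralZl//; last 2 first.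
  - by move=> w _; rewrite lee_fin sqr_ge0.
  - by rewrite lee_fin invr_ge0.
  by rewrite vE -EFinM mulrC.
apply: (le_lt_trans h).
have gk0 k w : (0 <= (g k (Y w) ^+ 2 / q ^+ k)%:E)%E.
  by rewrite lee_fin divr_ge0// sqr_ge0.
have mgk k : measurable_fun setT (fun w => (g k (Y w) ^+ 2 / q ^+ k)%:E).
  by apply: measurable_fun_EFin; apply: measurable_funM => //; exact: measurable_funX.
rewrite nneseriesZl; last by move=> k _; exact: integral_ge0.
rewrite -integral_nneseries//.
have qq : 0 <= 2 * q / (q - 1).
  by apply: divr_ge0; [rewrite mulr_ge0// ltW|rewrite subr_ge0 ltW].
apply: (@le_lt_trans _ _ (C1%:E * ((2 * q / (q - 1)) * e)%:E)%E); last first.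
  by rewrite -EFinM ltry.
rewrite lee_wpmul2l ?lee_fin// EFinM -eE -ge0_integralZl//.
apply: ge0_le_integral => //.
- by move=> w _; exact: nneseries_ge0.
- by apply: ge0_emeasurable_sum => // k w _ _.
- by apply: measurable_funeM.
- by move=> w _; exact: truncated_square_geometric_series.
Qed.

Let expX_unbounded (x : R) : exists k, x <= q ^+ k.
Proof.
have bern k : 1 + k%:R * (q - 1) <= q ^+ k.
  elim: k => [|k IH]; first by rewrite mul0r addr0 expr0.
  rewrite exprS -natr1; have k0 : 0 <= k%:R :> R by [].
  apply: (@le_trans _ _ (q * (1 + k%:R * (q - 1)))); last by rewrite ler_pM2l.
  rewrite -subr_ge0 [leRHS](_ : _ = k%:R * ((q - 1) ^+ 2)); last by ring.
  by rewrite mulr_ge0// sqr_ge0.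
exists (Num.truncn (x / (q - 1))).+1; apply: le_trans (bern _).
have /ltW := truncnS_gt (x / (q - 1)).
rewrite ler_pdivrMr ?subr_gt0// => /le_trans; apply.
by rewrite lerDr.
Qed.

(** Etemadi's proof: truncation at the level of time, Chebyshev and Borel-Cantelli
    along geometric times, monotonicity of the sums in between. The conclusion is
    a bound with a shift [C] valid for every [n], the form in which it enters the
    summations by parts below. Only an upper bound is proved: lower bounds come
    from applying it to complements of bounded variables. *)
Theorem strong_law_upper :
  {ae P, forall w, exists C : nat, forall n,
    (\sum_(i < n) f (X i w) <= (alpha * (n + C)%:R)%:E)%E}.
Proof.
have P0 := lim_sup_set_cvg0 mF sumPF.
exists (lim_sup_set F); split => //.
  by apply: bigcap_measurableType => k _; apply: bigcup_measurable => i _.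
move=> w; apply: contra_notP => nl.
have [k0 Hk0] : exists k0, forall k, (k0 <= k)%N -> ~ F k w.
  apply: contrapT => h; apply: nl => k _.
  apply: contrapT => h2; apply: h; exists k => j kj Fj.
  by apply: h2; exists j.
(* off the exceptional events the truncation is invisible *)
have block k : (k0 <= k)%N -> (\sum_(i < N k) f (X i w) <= ((N k)%:R * beta)%:E)%E.
  move=> /Hk0 nF.
  have fq i : (i < N k)%N -> (f (X i w) < (q ^+ k)%:E)%E.
    move=> iN; rewrite ltNge; apply/negP => h; apply: nF; right.
    by rewrite -bigcup_mkord; exists i.
  have -> : (\sum_(i < N k) f (X i w) = (\sum_(i < N k) g k (X i w))%:E)%E.
    rewrite -sumEFin; apply: eq_bigr => i _.
    by rewrite /g truncate_id// ltW// fq.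
  rewrite lee_fin leNgt; apply/negP => h; apply: nF; left.
  rewrite /A /= -mulrDr; apply: le_trans (ltW h).
  by rewrite ler_wpM2l// /eps; have := me k; lra.
exists (N k0) => n.
(* the first geometric time after [n], but not before [k0] *)
have [k /andP[k0k kn] kmin] : {k | (k0 <= k)%N && (n%:R <= q ^+ k) &
    forall j, (k0 <= j)%N && (n%:R <= q ^+ j) -> (k <= j)%N}.
  have ex : exists k, (k0 <= k)%N && (n%:R <= q ^+ k).
    have [k1 h] := expX_unbounded n%:R; exists (k0 + k1)%N; rewrite leq_addr/=.
    by apply: (le_trans h); rewrite ler_weXn2l ?leq_addl// ltW.
  by exists (ex_minn ex); case: ex_minnP.
have nN : (n <= N k)%N by rewrite -(ler_nat R) (le_trans kn)// ltW// N_gt.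
have sumle : (\sum_(i < n) f (X i w) <= \sum_(i < N k) f (X i w))%E.
  rewrite -!(big_mkord xpredT (fun i => f (X i w))).
  by rewrite (big_cat_nat _ nN)//= leeDl// sume_ge0.
apply: (le_trans sumle); apply: (le_trans (block k k0k)).
rewrite lee_fin natrD.
have [->|kk0] := eqVneq k k0.
  rewrite mulrC ler_pM ?(ltW beta0)// ?ler_addr ?lerDr//.
  by rewrite -betaq ler_peMr// ltW.
have k_gt0 : (0 < k)%N.
  by rewrite lt0n; apply: contraNneq kk0 => k00; rewrite k00 eq_sym -leqn0 -k00.
have nk : q ^+ k < q * n%:R.
  rewrite -(prednK k_gt0) exprS ltr_pM2l// ltNge; apply/negP => h.
  have := kmin k.-1; rewrite h andbT -ltnS prednK// ltn_neqAle eq_sym kk0 k0k.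
  by move=> /(_ isT); rewrite -ltnS prednK// ltnn.
have h1 : (N k)%:R * beta <= (q * n%:R + 1) * beta.
  by rewrite ler_wpM2r ?(ltW beta0)// (le_trans (N_le k))// lerD2r ltW.
apply: (le_trans h1); rewrite mulrDl mul1r mulrDr -betaq.
rewrite [X in X + _](_ : _ = beta * q * n%:R); last by ring.
rewrite lerD2l.
by rewrite -mulrA ler_peMr ?(ltW beta0)// mulr_ege1 ?ler1n// ltW.
Qed.

End Etemadi.
End StrongLaw.

(** * Products and tails of integrals *)

Lemma mutually_independent_pair d (Omega : measurableType d) (R : realType)
    (P : probability Omega R) d' (E : measurableType d') (I : choiceType)
    (X : I -> Omega -> E) i j :
  mutually_independent P X -> i <> j -> indep P (X i) (X j).
Proof.
move=> XI /eqP ij A B mA mB.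
have := XI [:: i; j] (fun k => if k == i then A else B).
rewrite !big_cons big_nil mule1 eqxx eq_sym (negbTE ij) => <-.
- congr (P _); apply/seteqP; split => [w [/= wA wB] k /=|w /= h].
    by rewrite !inE => /orP[] /eqP ->; rewrite ?eqxx// eq_sym (negbTE ij).
  split; first by have := h i; rewrite /= !inE eqxx; exact.
  by have := h j; rewrite /= !inE eqxx orbT eq_sym (negbTE ij); exact.
- by rewrite /= inE ij.
- by move=> k _; case: ifP.
Qed.

(** The last factor is independent of the family of the first ones, seen as a
    single random element. *)
Lemma integral_iid_prod d (Omega : measurableType d) (R : realType)
    (P : probability Omega R) d' (E : measurableType d')
    (X : nat -> Omega -> E) (Y : Omega -> E) (f : E -> R) (phi : R) (i : nat) :
  independent_copies P X Y -> measurable_fun setT Y ->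
  measurable_fun setT f -> (forall x, 0 <= f x) ->
  (\int[P]_w (f (Y w))%:E)%E = phi%:E ->
  (\int[P]_w (\prod_(k < i) f (X k w))%:E)%E = (phi ^+ i)%:E.
Proof.
move=> XY mY mf f0 fphi; have [mX _ lX] := XY.
elim: i => [|i IH].
  under eq_integral do rewrite big_ord0.
  by rewrite integral_cst//= probability_setT mule1.
under eq_integral do rewrite big_ord_recr/= EFinM.
have mp : measurable_fun setT
    (fun x : process_space 'I_i E => (\prod_(k < i) f (x k))%:E).
  apply: measurable_fun_EFin; apply: measurable_prod => k _.
  by apply: measurableT_comp => //; exact: measurable_coord.
have mu : measurable_fun setT (fun x : process_space unit E => (f (x tt))%:E).
  apply: measurable_fun_EFin.
  by apply: measurableT_comp => //; exact: measurable_coord.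
have mf' : measurable_fun setT (fun x => (f x)%:E) by exact: measurable_fun_EFin.
have vI : injective (fun k : 'I_i => k : nat) by exact: ord_inj.
have uI : injective (fun _ : unit => i) by move=> [] [].
rewrite (@integral_indep _ _ _ P _ _ _ _ _ _
  (fun x : process_space 'I_i E => (\prod_(k < i) f (x k))%:E)
  (fun x : process_space unit E => (f (x tt))%:E)
  (measurable_subprocess XY (fun k : 'I_i => k : nat))
  (measurable_subprocess XY (fun _ : unit => i)))//=.
- rewrite IH exprSr EFinM -fphi; congr (_ * _)%E.
  by apply: (same_law_integral (mX i) mY (lX i) mf') => x; rewrite lee_fin.
- apply: (subprocess_indep XY vI uI).
  by move=> k _ e; have := ltn_ord k; rewrite e ltnn.
- by move=> x; rewrite lee_fin prodr_ge0.
- by move=> x; rewrite lee_fin.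
Qed.

(** The integrals over the increasing sets [F n] converge to the whole integral,
    which is finite. *)
Lemma integral_small_tail d (T : measurableType d) (R : realType)
    (mu : {measure set T -> \bar R}) (f : T -> \bar R) (F : nat -> set T) (eps : R) :
  measurable_fun setT f -> (forall x, (0 <= f x)%E) -> (\int[mu]_x f x < +oo)%E ->
  (forall n, measurable (F n)) -> (forall n m, (n <= m)%N -> F n `<=` F m) ->
  {ae mu, forall x, exists n, F n x} -> 0 < eps ->
  exists n, (\int[mu]_(x in ~` F n) f x < eps%:E)%E.
Proof.
move=> mf f0 fi mF Fnd aeF eps0.
have split_int n : (\int[mu]_x f x = \int[mu]_(x in F n) f x + \int[mu]_(x in ~` F n) f x)%E.
  rewrite -ge0_integral_setU//; last 3 first.
  - exact: measurableC.
  - by rewrite setUv.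
  - by apply/disj_setPS => x [].
  by rewrite setUv.
have mU : measurable (\bigcup_n F n) by exact: bigcup_measurable.
have cvgF : (\int[mu]_(x in F n) f x)%E @[n --> \oo] --> (\int[mu]_x f x)%E.
  have -> : (\int[mu]_x f x = \int[mu]_(x in \bigcup_n F n) f x)%E.
    have mCU : measurable (~` \bigcup_n F n) by exact: measurableC.
    rewrite (@ge0_negligible_integral _ _ _ mu setT (~` \bigcup_n F n))//.
      by rewrite setTD setCK.
    have [N [mN N0 sN]] := aeF.
    apply: (subset_measure0 mCU mN) => // x nx; apply: sN => -[n Fnx].
    by apply: nx; exists n.
  apply: ge0_nondecreasing_set_cvg_integral => //.
  - by move=> n m nm; apply/subsetPset; exact: Fnd.
  - by move=> n; exact: measurable_funS mf.
have I0 : (0 <= \int[mu]_x f x)%E by exact: integral_ge0.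
have Ifin : (\int[mu]_x f x)%E \is a fin_num by rewrite ge0_fin_numE.
have [|n _ /(_ n (leqnn _)) h] := cvgF [set y | (\int[mu]_x f x - eps%:E < y)%E] _.
  apply: open_nbhs_nbhs; split; first exact: open_ereal_gt_ereal.
  by rewrite /mkset lteBlDr// lteDl ?lte_fin.
have {}h : (\int[mu]_x f x - eps%:E < \int[mu]_(x in F n) f x)%E := h.
exists n; move: h; rewrite (split_int n) => h.
have IF0 : (0 <= \int[mu]_(x in F n) f x)%E by exact: integral_ge0.
have IF : (\int[mu]_(x in F n) f x)%E \is a fin_num.
  rewrite ge0_fin_numE// (le_lt_trans _ fi)// (split_int n) leeDl//.
  exact: integral_ge0.
move: (\int[mu]_(x in F n) f x)%E (\int[mu]_(x in ~` F n) f x)%E IF h => a b af.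
by rewrite lteBlDr// lteD2lE.
Qed.

(** * The perturbed random walk *)

Section MeasurableQuantifiers.
Context d (T : measurableType d).

Lemma measurable_exists_nat (Q : nat -> T -> Prop) :
  (forall n, measurable [set x | Q n x]) -> measurable [set x | exists n, Q n x].
Proof.
move=> mQ; rewrite [X in measurable X](_ : _ = \bigcup_n [set x | Q n x]).
  by apply: bigcup_measurable => n _.
by apply/seteqP; split => x [n]; [exists n|exists n].
Qed.

Lemma measurable_forall_nat (Q : nat -> T -> Prop) :
  (forall n, measurable [set x | Q n x]) -> measurable [set x | forall n, Q n x].
Proof.
move=> mQ; rewrite [X in measurable X](_ : _ = \bigcap_n [set x | Q n x]).
  by apply: bigcap_measurableType => n _.
by apply/seteqP; split => x h; [move=> n _; exact: h|move=> n; exact: h].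
Qed.

Lemma measurable_le_fun (R : realType) (f g : T -> R) :
  measurable_fun setT f -> measurable_fun setT g -> measurable [set x | f x <= g x].
Proof.
by move=> mf mg; rewrite -[X in measurable X]setTI; exact: measurable_fun_le.
Qed.

Lemma measurable_lt_fun (R : realType) (f g : T -> R) :
  measurable_fun setT f -> measurable_fun setT g -> measurable [set x | f x < g x].
Proof.
move=> mf mg; rewrite [X in measurable X](_ : _ = ~` [set x | g x <= f x]).
  by apply: measurableC; exact: measurable_le_fun.
apply/seteqP; split => x /=; first by move=> h; apply/negP; rewrite -ltNge.
by move=> /negP; rewrite -ltNge.
Qed.

Lemma measurable_lee_fun (R : realType) (f g : T -> \bar R) :
  measurable_fun setT f -> measurable_fun setT g ->
  measurable [set x | (f x <= g x)%E].
Proof.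
move=> mf mg; have /(_ measurableT [set true] Logic.I) := measurable_fun_lee mf mg.
by rewrite setTI.
Qed.

End MeasurableQuantifiers.

Section SequenceSpace.
Context (R : realType).

Lemma measurable_sequence_coord (i : nat) :
  measurable_fun setT (fun t : sequence_space R => t i).
Proof.
move=> _ A mA; rewrite setTI; apply: sub_sigma_algebra.
by exists i, A.
Qed.

Lemma measurable_to_sequence d (T : measurableType d) (X : T -> sequence_space R) :
  (forall i, measurable_fun setT (fun w => X w i)) -> measurable_fun setT X.
Proof.
move=> mX; apply: measurability; first by [].
move=> _ [_ [i [B [mB ->]]] <-]; rewrite setTI.
by apply: (@measurable_preimage _ _ _ _ (fun w => X w i)).
Qed.

Definition late_indices (mu : R) (i : nat) : set (sequence_space R) :=
  [set t | mu * i%:R < t i].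

Lemma measurable_late_indices mu i : measurable (late_indices mu i).
Proof. by apply: measurable_lt_fun => //; exact: measurable_sequence_coord. Qed.

Definition nonneg_sequence : set (sequence_space R) := [set t | forall i, 0 <= t i].

(** For [mu] on either side of the mean step, the next two events say that [t i]
    grows at that rate in the sense that survives perturbations without moments:
    from below for all indices, from above outside a set of indices of small
    density. The constant [C] accounts for the finitely many exceptional indices.
    They are measurable, so they pass from the perturbed random walk to every
    sequence with the same law. *)
Definition linear_lower (mu : R) : set (sequence_space R) :=
  [set t | exists C : nat, forall i, mu * (i%:R - C%:R) <= t i].

Definition rarely_late (mu delta : R) : set (sequence_space R) :=
  [set t | exists C : nat, forall n,
     \sum_(i < n) \1_(late_indices mu i) t <= delta * (n + C)%:R].

Lemma measurable_nonneg_sequence : measurable nonneg_sequence.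
Proof.
apply: measurable_forall_nat => i.
by apply: measurable_le_fun => //; exact: measurable_sequence_coord.
Qed.

Lemma measurable_linear_lower mu : measurable (linear_lower mu).
Proof.
apply: measurable_exists_nat => C; apply: measurable_forall_nat => i.
by apply: measurable_le_fun => //; exact: measurable_sequence_coord.
Qed.

Lemma measurable_rarely_late mu delta : measurable (rarely_late mu delta).
Proof.
apply: measurable_exists_nat => C; apply: measurable_forall_nat => n.
apply: measurable_le_fun => //; apply: measurable_sum => i.
by apply: measurable_indic; exact: measurable_late_indices.
Qed.

End SequenceSpace.

Lemma probability_ae_exists d (T : measurableType d) (R : realType)
    (P : probability T R) (Q : T -> Prop) :
  {ae P, forall w, Q w} -> exists w, Q w.
Proof.
move=> [N [mN N0 sN]]; apply: contrapT => nQ.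
have : P setT = 0%E.
  apply: (subset_measure0 measurableT mN) => // w _; apply: sN => Qw.
  by apply: nQ; exists w.
by rewrite probability_setT => /eqP; rewrite eqe oner_eq0.
Qed.

Section PerturbedRandomWalk.
Context (R : realType) (d : measure_display) (Omega : measurableType d)
  (P : probability Omega R) (xi eta : {RV P >-> R}) (xis etas : nat -> Omega -> R).
Hypothesis hpos : {ae P, forall w, 0 < xi w /\ 0 < eta w}.
Hypothesis hcopies : independent_copies P (fun i w => (xis i w, etas i w))
                                    (fun w => (xi w, eta w)).
Hypothesis hm : ('E_P[xi] < +oo)%E.

Let m := fine 'E_P[xi].
Let Z i w := (xis i w, etas i w).
Let Z0 w := (xi w, eta w).

Let mZ i : measurable_fun setT (Z i).
Proof. by case: hcopies => h _ _; exact: h. Qed.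

Let mZ0 : measurable_fun setT Z0.
Proof. by apply: measurable_fun_pair; exact: measurable_funP. Qed.

Let ZI i j : i <> j -> indep P (Z i) (Z j).
Proof. by case: hcopies => _ h _ ij; exact: (mutually_independent_pair h). Qed.

Let ZZ0 i : same_law P (Z i) Z0.
Proof. by case: hcopies => _ _ h; exact: h. Qed.

Let ZZ0' i : same_law P Z0 (Z i).
Proof. by move=> A mA; rewrite ZZ0. Qed.

Let mxis i : measurable_fun setT (xis i).
Proof. exact: (measurableT_comp measurable_fst (mZ i)). Qed.

Let metas i : measurable_fun setT (etas i).
Proof. exact: (measurableT_comp measurable_snd (mZ i)). Qed.

Let T := perturbed_random_walk xis etas.

Lemma measurable_perturbed_random_walk : measurable_fun setT T.
Proof.
apply: measurable_to_sequence => i; apply: measurable_funD => //.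
exact: measurable_sum.
Qed.

Lemma steps_positive : {ae P, forall w, forall i, 0 < xis i w /\ 0 < etas i w}.
Proof.
apply: ae_foralln => i.
have mpos : measurable [set z : R * R | 0 < z.1 /\ 0 < z.2].
  apply: measurableI; apply: measurable_lt_fun => //.
exact: (same_law_ae mZ0 (mZ i) (@ZZ0' i) mpos hpos).
Qed.

Let size_of (z : R * R) : \bar R := `|z.1|%:E.

Let msize : measurable_fun setT size_of.
Proof. by apply: measurable_fun_EFin; exact: measurableT_comp. Qed.

Let size0 z : (0 <= size_of z)%E.
Proof. by rewrite lee_fin. Qed.

Let int_size : (\int[P]_w size_of (Z0 w) = 'E_P[xi])%E.
Proof.
rewrite unlock; apply: ae_eq_integral => //.
- exact: measurableT_comp.
- by apply: measurable_fun_EFin; exact: measurable_funP.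
- by apply: filterS hpos => w [x0 _] _; rewrite /size_of/= gtr0_norm.
Qed.

Lemma int_size_fin : (\int[P]_w size_of (Z0 w) = m%:E)%E.
Proof.
rewrite /m -int_size fineK// ge0_fin_numE ?int_size//.
by rewrite -int_size; exact: integral_ge0.
Qed.

Lemma mean_step_gt0 : 0 < m.
Proof.
rewrite lt_neqAle -lee_fin -int_size_fin integral_ge0// andbT.
apply/eqP => m0; have /eqP := int_size_fin; rewrite -m0 => /eqP.
under eq_integral do rewrite -(gee0_abs (size0 _)).
move=> /(ae_eq_integral_abs P measurableT (measurableT_comp msize mZ0)) h.
have [w [/(_ Logic.I) hw [x0 _]]] := probability_ae_exists (filterI h hpos).
by move: hw; rewrite /size_of/= => -[/eqP]; rewrite normr_eq0 gt_eqF.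
Qed.

Let S i w := \sum_(k < i) `|xis k w|.

(** The strong law is applied to the nonnegative variables
    [b - min (`|xi|, b)], where [b] is so large that truncation at [b] costs less
    than [m - mu]. *)
Lemma walk_linear_lower mu : 0 < mu -> mu < m ->
  {ae P, forall w, exists C : nat, forall i, mu * (i%:R - C%:R) <= S i w}.
Proof.
move=> mu0 mum.
have eps0 : 0 < m - mu by rewrite subr_gt0.
pose F (n : nat) := [set w | `|xi w| <= n%:R].
have mxi : measurable_fun setT (fun w => `|xi w|).
  by apply: measurableT_comp => //; exact: measurable_funP.
have mF n : measurable (F n) by apply: measurable_le_fun.
have [n hn] : exists n, (\int[P]_(w in ~` F n) `|xi w|%:E < (m - mu)%:E)%E.
  apply: integral_small_tail => //.
  - exact: measurable_fun_EFin.
  - by have := int_size_fin; rewrite /size_of/= => ->; rewrite ltry.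
  - by move=> a b ab w /le_trans; apply; rewrite ler_nat.
  - apply: aeW => w; exists (Num.truncn `|xi w|).+1.
    exact/ltW/truncnS_gt.
pose b := n%:R : R.
pose f (z : R * R) := (b - Order.min `|z.1| b)%:E.
have f0 z : (0 <= f z)%E by rewrite lee_fin subr_ge0 ge_min lexx orbT.
have mmin : measurable_fun setT (fun z : R * R => Order.min `|z.1| b).
  by apply: measurable_minr => //; exact: measurableT_comp.
have mf : measurable_fun setT f.
  by apply: measurable_fun_EFin; exact: measurable_funB.
have intmin : (m%:E <= \int[P]_w (Order.min `|xi w| b)%:E +
    \int[P]_(w in ~` F n) `|xi w|%:E)%E.
  rewrite -int_size_fin.
  have -> : (\int[P]_(w in ~` F n) `|xi w|%:E =
      \int[P]_w (`|xi w| * \1_(~` F n) w)%:E)%E.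
    rewrite integral_mkcond; apply: eq_integral => w _.
    rewrite patchE indicE; case: ifP => _; first by rewrite mulr1.
    by rewrite mulr0.
  rewrite -ge0_integralD//; last 3 first.
  - by move=> w _; rewrite lee_fin le_min normr_ge0/=.
  - by apply: measurable_fun_EFin; exact: measurable_minr.
  - apply: measurable_fun_EFin; apply: measurable_funM => //.
    by apply: measurable_indic; exact: measurableC.
  apply: ge0_le_integral => //.
  - by apply: measurable_fun_EFin.
  - apply: emeasurable_funD; apply: measurable_fun_EFin; first exact: measurable_minr.
    by apply: measurable_funM => //; apply: measurable_indic; exact: measurableC.
  - move=> w _; rewrite -EFinD lee_fin /size_of/= indicE.
    have [h|h] := boolP (w \in ~` F n).
      by rewrite mulr1 lerDr le_min normr_ge0/=.
    rewrite mulr0 addr0 le_min lexx/=.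
    by move: h; rewrite notin_setE => /contrapT.
have fint : (\int[P]_w f (Z0 w) < (b - mu)%:E)%E.
  have : (\int[P]_w f (Z0 w) + \int[P]_w (Order.min `|xi w| b)%:E = b%:E)%E.
    rewrite -ge0_integralD//; last 3 first.
    - exact: measurableT_comp.
    - by move=> w _; rewrite lee_fin le_min normr_ge0/=.
    - by apply: measurable_fun_EFin; exact: measurable_minr.
    under eq_integral do rewrite -EFinD subrK.
    by rewrite integral_cst//= probability_setT mule1.
  move: intmin hn.
  have : (0 <= \int[P]_w f (Z0 w))%E by exact: integral_ge0.
  have : (0 <= \int[P]_w (Order.min `|xi w| b)%:E)%E.
    by apply: integral_ge0 => w _; rewrite lee_fin le_min normr_ge0/=.
  have : (0 <= \int[P]_(w in ~` F n) `|xi w|%:E)%E.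
    by apply: integral_ge0 => w _; rewrite lee_fin.
  move: (\int[P]_w f (Z0 w))%E (\int[P]_(w in ~` F n) `|xi w|%:E)%E
    (\int[P]_w (Order.min `|xi w| b)%:E)%E => [x| |] [y| |] [z| |] //=.
  rewrite -!EFinD !lee_fin !lte_fin => ? ? ? ? ? [?]; lra.
have := strong_law_upper mZ mZ0 ZI ZZ0 mf f0 fint.
apply: filterS => w [C hC].
exists (Num.truncn ((b - mu) * C%:R / mu)).+1 => i.
have : \sum_(k < i) (b - Order.min `|xis k w| b) <= (b - mu) * (i + C)%:R.
  by rewrite -lee_fin -sumEFin; exact: hC.
rewrite sumrB sumr_const card_ord -mulr_natl natrD => h.
have h1 : \sum_(k < i) Order.min `|xis k w| b <= S i w.
  by apply: ler_sum => k _; rewrite ge_min lexx.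
have := truncnS_gt ((b - mu) * C%:R / mu).
rewrite ltr_pdivrMr//; nra.
Qed.

Lemma walk_linear_upper mu : m < mu ->
  {ae P, forall w, exists C : nat, forall i, S i w <= mu * (i + C)%:R}.
Proof.
move=> mmu.
have fint : (\int[P]_w size_of (Z0 w) < mu%:E)%E by rewrite int_size_fin lte_fin.
have := strong_law_upper mZ mZ0 ZI ZZ0 msize size0 fint.
apply: filterS => w [C hC]; exists C => i.
by rewrite -lee_fin /S -sumEFin; exact: hC.
Qed.

(** As [eta] is finite, some level is exceeded with small probability, hence with
    small frequency. *)
Lemma large_perturbations_rare delta : 0 < delta ->
  exists c : R, {ae P, forall w, exists C : nat, forall n,
    \sum_(i < n) (\1_[set x : R | c < x] (etas i w) : R) <= delta * (n + C)%:R}.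
Proof.
move=> delta0.
pose F (n : nat) := [set w | eta w <= n%:R].
have meta : measurable_fun setT eta by exact: measurable_funP.
have mF n : measurable (F n) by apply: measurable_le_fun.
have [n hn] : exists n, (\int[P]_(w in ~` F n) (cst 1%E w) < delta%:E)%E.
  apply: integral_small_tail => //.
  - by rewrite integral_cst//= probability_setT mule1 ltry.
  - by move=> a b ab w /le_trans; apply; rewrite ler_nat.
  - apply: aeW => w; exists (Num.truncn (eta w)).+1.
    exact/ltW/truncnS_gt.
exists n%:R.
have mA : measurable [set x : R | n%:R < x] by apply: measurable_lt_fun.
pose f (z : R * R) := (\1_[set x : R | n%:R < x] z.2 : R)%:E.
have f0 z : (0 <= f z)%E by rewrite lee_fin.
have mf : measurable_fun setT f.
  apply: measurable_fun_EFin.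
  by apply: (measurableT_comp (measurable_indic mA)).
have fint : (\int[P]_w f (Z0 w) < delta%:E)%E.
  apply: le_lt_trans hn; rewrite [leRHS]integral_mkcond.
  rewrite le_eqVlt; apply/orP; left; apply/eqP; apply: eq_integral => w _.
  rewrite patchE /f /Z0/= indicE.
  have [h|h] := boolP (w \in ~` F n); [rewrite mem_set//|rewrite memNset//].
    by move: h; rewrite inE => /negP; rewrite -ltNge.
  by move: h; rewrite notin_setE => /contrapT h; apply/negP; rewrite -leNgt.
have := strong_law_upper mZ mZ0 ZI ZZ0 mf f0 fint.
apply: filterS => w [C hC]; exists C => i.
by rewrite -lee_fin -sumEFin; exact: hC.
Qed.

Lemma perturbed_walk_nonneg : {ae P, forall w, nonneg_sequence (T w)}.
Proof.
apply: filterS steps_positive => w h i.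
by rewrite addr_ge0 ?sumr_ge0 ?ltW ?(h i).2// => k _; rewrite ltW ?(h k).1.
Qed.

Let perturbed_walkE : {ae P, forall w i, T w i = S i w + etas i w}.
Proof.
apply: filterS steps_positive => w h i; congr (_ + _).
by apply: eq_bigr => k _; rewrite gtr0_norm ?(h k).1.
Qed.

Lemma perturbed_walk_linear_lower mu : 0 < mu -> mu < m ->
  {ae P, forall w, linear_lower mu (T w)}.
Proof.
move=> mu0 mum.
apply: filterS3 (walk_linear_lower mu0 mum) perturbed_walkE steps_positive.
move=> w [C hC] TE h; exists C => i; rewrite TE.
by apply: (le_trans (hC i)); rewrite lerDl ltW ?(h i).2.
Qed.

(** Let [mu'] be between [m] and [mu]. As the walk stays below [mu' * (i + C1)],
    an index can be late only if its perturbation exceeds [c] or if it is below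
    a constant [C3]. *)
Lemma perturbed_walk_rarely_late mu delta : m < mu -> 0 < delta ->
  {ae P, forall w, rarely_late mu delta (T w)}.
Proof.
move=> mmu delta0; have [c hc] := large_perturbations_rare delta0.
pose mu' := (m + mu) / 2.
have mmu' : m < mu' by rewrite /mu'; lra.
have mu'mu : 0 < mu - mu' by rewrite /mu'; lra.
apply: filterS3 (walk_linear_upper mmu') perturbed_walkE hc.
move=> w [C1 hC1] TE [C2 hC2].
pose C3 := (Num.truncn ((mu' * C1%:R + c) / (mu - mu'))).+1.
(* [C3] early indices weigh less than [delta * C4] *)
pose C4 := (Num.truncn (C3%:R / delta)).+1.
have late i : (\1_(late_indices mu i) (T w) : R) <=
    (i < C3)%N%:R + \1_[set x : R | c < x] (etas i w).
  rewrite indicE; have [|_] := boolP (T w \in _); last by rewrite addr_ge0.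
  rewrite inE /late_indices/= TE => hi.
  have [//|iC3] := ltnP i C3; first by rewrite lerDl.
  rewrite add0r indicE mem_set//=.
  rewrite ltNge; apply/negP => ec.
  have h1 := hC1 i; have h2 := truncnS_gt ((mu' * C1%:R + c) / (mu - mu')).
  rewrite ltr_pdivrMr// -/C3 in h2.
  have h3 : C3%:R <= i%:R :> R by rewrite ler_nat.
  rewrite natrD in h1; nra.
have countC3 n : (\sum_(i < n) (i < C3) <= minn n C3)%N.
  elim: n => [|n IH]; first by rewrite big_ord0.
  rewrite big_ord_recr/=; move: (\sum_(i < n) (i < C3))%N IH => s.
  by have [h|h] := ltnP n C3 => /=; lia.
exists (C2 + C4)%N => n.
have hs : \sum_(i < n) (\1_(late_indices mu i) (T w) : R) <=
    \sum_(i < n) ((i < C3)%N%:R + \1_[set x : R | c < x] (etas i w)).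
  by apply: ler_sum => i _; exact: late.
apply: (le_trans hs); rewrite big_split/=.
have := hC2 n; have : \sum_(i < n) ((i < C3)%N%:R : R) <= C3%:R.
  by rewrite -natr_sum ler_nat (leq_trans (countC3 n))// geq_minr.
have := truncnS_gt (C3%:R / delta); rewrite ltr_pdivrMr// -/C4.
rewrite !natrD; nra.
Qed.

(** With [phi] the Laplace transform of the step at 1, which is below 1 because the
    step is positive; the perturbation only decreases the left-hand side. *)
Lemma perturbed_walk_laplace : exists phi : R, [/\ 0 <= phi, phi < 1 &
  forall i, (\int[P]_w (expR (- T w i))%:E <= (phi ^+ i)%:E)%E].
Proof.
pose f (z : R * R) := expR (- `|z.1|).
have f0 z : 0 <= f z by exact: expR_ge0.
have f1 z : f z <= 1 by rewrite -expR0 ler_expR oppr_le0.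
have mf : measurable_fun setT f.
  apply: measurableT_comp => //; apply: measurableT_comp => //.
  exact: measurableT_comp.
have mfZ0 : measurable_fun setT (fun w => f (Z0 w)) by exact: measurableT_comp.
have I0 : (0 <= \int[P]_w (f (Z0 w))%:E)%E.
  by apply: integral_ge0 => w _; rewrite lee_fin.
have split1 : (\int[P]_w (f (Z0 w))%:E + \int[P]_w (1 - f (Z0 w))%:E = 1)%E.
  rewrite -ge0_integralD//.
  - under eq_integral do rewrite -EFinD addrCA subrr addr0.
    by rewrite integral_cst//= probability_setT mule1.
  - by move=> w _; rewrite lee_fin.
  - exact: measurable_fun_EFin.
  - by move=> w _; rewrite lee_fin subr_ge0.
  - by apply: measurable_fun_EFin; exact: measurable_funB.
have J0 : (0 <= \int[P]_w (1 - f (Z0 w))%:E)%E.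
  by apply: integral_ge0 => w _; rewrite lee_fin subr_ge0.
pose phi := fine (\int[P]_w (f (Z0 w))%:E).
have phiE : (\int[P]_w (f (Z0 w))%:E = phi%:E)%E.
  rewrite /phi fineK// ge0_fin_numE//.
  by rewrite (@le_lt_trans _ _ 1%E) ?ltry// -split1 leeDl.
have phi0 : 0 <= phi by exact: fine_ge0.
exists phi; split => // [|i].
  rewrite ltNge; apply/negP => phi1.
  have J : (\int[P]_w (1 - f (Z0 w))%:E)%E = 0%E.
    apply/eqP; rewrite eq_le J0 andbT.
    move: split1 J0; rewrite phiE.
    by case: (\int[P]_w _)%E => [r [] | |]//; rewrite !lee_fin => ? ?; lra.
  have : (\int[P]_w `|(1 - f (Z0 w))%:E| = 0)%E.
    by under eq_integral do rewrite gee0_abs ?lee_fin ?subr_ge0//.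
  have mJ : measurable_fun setT (fun w => (1 - f (Z0 w))%:E).
    by apply: measurable_fun_EFin; exact: measurable_funB.
  move=> /(ae_eq_integral_abs P measurableT mJ) h.
  have [w [/(_ Logic.I) /= hw [x0 _]]] := probability_ae_exists (filterI h hpos).
  move: hw => [/eqP]; rewrite subr_eq0 /f/= eq_sym -expR0 => /eqP /expR_inj /eqP.
  by rewrite oppr_eq0 normr_eq0 gt_eqF.
rewrite -(integral_iid_prod i hcopies mZ0 mf f0 phiE).
apply: ae_ge0_le_integral => //.
- apply: measurable_fun_EFin; apply: measurableT_comp => //.
  apply: measurableT_comp => //.
  apply: (measurableT_comp (measurable_sequence_coord i)).
  exact: measurable_perturbed_random_walk.
- by move=> w _; rewrite lee_fin prodr_ge0.
- apply: measurable_fun_EFin; apply: measurable_prod => k _.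
  exact: (measurableT_comp mf (mZ k)).
apply: filterS2 perturbed_walkE steps_positive => w TE h _.
rewrite lee_fin /f -expR_sum ler_expR sumrN/= lerN2 TE lerDl.
by rewrite ltW ?(h i).2.
Qed.

End PerturbedRandomWalk.

(** * Trees and their generation counts *)

Section CountingSeries.
Context (R : realType).
Local Open Scope ereal_scope.

Lemma counting_esum (T : choiceType) (A : set T) :
  counting A = \esum_(u in A) (1 : \bar R).
Proof.
rewrite /counting; case: ifPn => /asboolP fA.
  rewrite esum_fset//.
  rewrite fsbig_finite//= big_const_seq count_predT.
  by elim: (size _) => //= n <-; rewrite -EFinD -natr1 addrC.
apply/esym/eq_infty => r.
have [B BA cB] := infinite_set_fset (Num.truncn `|r|).+1 fA.
apply: esum_ge; exists [set` B]; first by split => //; exact: finite_fset.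
rewrite fsbig_finite//= set_fsetK big_const_seq count_predT.
have -> : iter (size B) (fun y : \bar R => 1 + y) 0 = (size B)%:R%:E.
  by elim: (size B) => //= n ->; rewrite -EFinD -natr1 addrC.
rewrite lee_fin (le_trans (ler_norm r))// (le_trans (ltW (truncnS_gt _)))//.
by rewrite ler_nat.
Qed.

Lemma nneseries_finite_support (f : nat -> \bar R) n :
  (forall i, 0 <= f i) -> (forall i, (n <= i)%N -> f i = 0) ->
  \sum_(0 <= i <oo) f i = \sum_(i < n) f i.
Proof.
move=> f0 fn; rewrite (nneseries_split 0 n)// add0n big_mkord.
by rewrite eseries0 ?adde0// => i ni _; exact: fn.
Qed.

Lemma nneseries_geometric_fin (x : R) : (0 <= x)%R -> (x < 1)%R ->
  \sum_(0 <= i <oo) (x ^+ i)%:E < +oo.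
Proof.
move=> x0 x1; apply: (@le_lt_trans _ _ ((1 - x)^-1)%:E); last exact: ltry.
apply: lime_le.
  by apply: is_cvg_nneseries => i _ _; rewrite lee_fin exprn_ge0.
apply: nearW => n; rewrite sumEFin lee_fin big_mkord.
rewrite -[leRHS]mul1r ler_pdivlMr ?subr_gt0// mulrC.
have -> : (1 - x = - (x - 1))%R by rewrite opprB.
by rewrite mulNr -subrX1 opprB gerBl exprn_ge0.
Qed.

End CountingSeries.

Section Trees.
Context (R : realType).

(** A realisation of the whole branching process: the displacements of the
    children of every word. When these displacements are independent copies of
    one sequence, the subtrees at the children of the root are iid with the law of
    the tree itself. *)
Definition tree := process_space (seq nat) (sequence_space R).

Definition subtree (i : nat) (x : tree) : tree := fun v => x (i :: v).

Lemma measurable_subtree i : measurable_fun setT (subtree i).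
Proof. by apply: measurable_process => v; exact: measurable_coord. Qed.

Lemma measurable_offspring u i : measurable_fun setT (fun x : tree => x u i).
Proof.
exact: (measurableT_comp (measurable_sequence_coord i)
  (@measurable_coord _ _ (sequence_space R) u)).
Qed.

Definition nonneg_tree : set tree := [set x | forall u, nonneg_sequence (x u)].

Lemma nonneg_subtree i x : nonneg_tree x -> nonneg_tree (subtree i x).
Proof. by move=> x0 v; exact: x0. Qed.

(** The count of the generation [p] up to time [s], decomposed at the first
    generation. *)
Fixpoint gcount (p : nat) (s : R) (x : tree) : \bar R :=
  if p is p'.+1 then
    (\sum_(0 <= i <oo) gcount p' (s - x [::] i)%R (subtree i x))%E
  else ((0 <= s)%R%:R)%:E.

Lemma gcount_ge0 p s x : (0 <= gcount p s x)%E.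
Proof.
elim: p s x => [|p IH] s x /=; first by rewrite lee_fin.
exact: nneseries_ge0.
Qed.

Lemma le_gcount p s t x : s <= t -> (gcount p s x <= gcount p t x)%E.
Proof.
elim: p s t x => [|p IH] s t x st /=.
  rewrite lee_fin ler_nat; case: (leP 0 s) => // s0.
  by rewrite (le_trans s0).
apply: lee_nneseries => i.
  by move=> _ _; exact: gcount_ge0.
by move=> _; apply: IH; rewrite lerD2r.
Qed.

Lemma gcount_neg p s x : nonneg_tree x -> s < 0 -> gcount p s x = 0%E.
Proof.
elim: p s x => [|p IH] s x x0 s0 /=; first by rewrite leNgt s0.
apply: eseries0 => i _ _; apply: IH; first exact: nonneg_subtree.
by rewrite ltrBlDr add0r (lt_le_trans s0)// x0.
Qed.

(** The time has to vary with the outcome, because the recursion shifts it by a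
    random displacement. *)
Lemma measurable_gcount p d (T : measurableType d) (s : T -> R) (X : T -> tree) :
  measurable_fun setT s -> measurable_fun setT X ->
  measurable_fun setT (fun w => gcount p (s w) (X w)).
Proof.
elim: p s X => [|p IH] s X ms mX /=.
  apply: measurable_fun_EFin.
  rewrite [X in measurable_fun _ X](_ : _ = \1_[set w | 0 <= s w]); last first.
    apply/funext => w; rewrite indicE; congr ((nat_of_bool _)%:R).
    by apply/idP/idP => [h|/set_mem//]; exact/mem_set.
  by apply: measurable_indic; exact: measurable_le_fun.
apply: ge0_emeasurable_sum => [i w _ _|i _]; first exact: gcount_ge0.
apply: IH.
  apply: measurable_funB => //.
  exact: (measurableT_comp (measurable_offspring [::] i) mX).
exact: (measurableT_comp (measurable_subtree i) mX).
Qed.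

Lemma birth_time_cons (Omega : Type) (T : seq nat -> Omega -> sequence_space R)
    i v w : birth_time T (i :: v) w =
    T [::] w i + birth_time (fun u => T (i :: u)) v w.
Proof. by rewrite /birth_time /= big_ord_recl/=. Qed.

Lemma generation_count_gcount (Omega : Type)
    (T : seq nat -> Omega -> sequence_space R) p s w :
  generation_count T p s w = gcount p s (fun u => T u w).
Proof.
rewrite /generation_count counting_esum.
elim: p s T => [|p IH] s T /=.
  have [s0|s0] := leP 0 s.
    rewrite [X in \esum_(_ in X) _](_ : _ = [set [tuple]]) ?esum_set1//.
    apply/seteqP; split => [u _|_ ->]; first by rewrite (tuple0 u).
    by rewrite /= /birth_time big_ord0.
  rewrite [X in \esum_(_ in X) _](_ : _ = set0) ?esum_set0//.
  apply/seteqP; split => // u; rewrite (tuple0 u)/= /birth_time big_ord0.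
  by rewrite leNgt s0.
pose child i : set (p.-tuple nat) :=
  [set v : p.-tuple nat | birth_time (fun u => T (i :: u)) v w <= s - T [::] w i].
pose F i : set (p.+1.-tuple nat) := [set cons_tuple i v | v in child i].
have -> : [set u : p.+1.-tuple nat | birth_time T u w <= s] = \bigcup_i F i.
  apply/seteqP; split => [u|u [i _ [v hv <-]]].
    case/tupleP: u => i v h; exists i => //; exists v => //.
    by rewrite /child/= lerBrDl -birth_time_cons.
  by rewrite /= birth_time_cons -lerBrDl.
rewrite nneseries_sum_bigcup//; last first.
  apply/trivIsetP => i j _ _ ij; apply/seteqP; split => // _ [[v _ <-] [v' _]].
  by move=> /(congr1 val) /= [ji]; rewrite ji eqxx in ij.
apply: eq_eseriesr => i _; rewrite esum_image.
  by rewrite -[RHS](IH (s - T [::] w i) (fun u => T (i :: u))).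
by move=> v v' _ _ /(congr1 val) /= [] /val_inj.
Qed.

End Trees.

(** * Binomial sums and an integrable envelope *)

Section BinomialSums.

Lemma binS_shift n p : 'C(n.+1 + p.+1, p.+1) = ('C(n + p.+1, p.+1) + 'C(n.+1 + p, p))%N.
Proof. by rewrite addSn binS addnS. Qed.

Lemma hockey_stick n p : (\sum_(i < n.+1) 'C(n - i + p, p) = 'C(n + p.+1, p.+1))%N.
Proof.
rewrite (reindex_inj rev_ord_inj)/=.
under eq_bigr => i _ do rewrite subSS subKn -1?ltnS//.
elim: n => [|n IH]; first by rewrite big_ord_recr big_ord0/= !add0n !binn.
by rewrite big_ord_recr/= IH -binS_shift.
Qed.

Lemma bin_dilate (c n p : nat) : (0 < c)%N ->
  ('C(c * n + p, p) <= c ^ p * 'C(n + p, p))%N.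
Proof.
move=> c0; elim: p => [|p IH]; first by rewrite !addn0 !bin0 expn0.
rewrite -(leq_pmul2l (ltn0Sn p)) addnS -mul_bin_diag.
have h : ((c * n + p).+1 <= c * (n + p).+1)%N by nia.
apply: (leq_trans (leq_mul h IH)).
rewrite (_ : n + p.+1 = (n + p).+1)%N ?addnS//.
by rewrite [leqRHS]mulnCA -mul_bin_diag expnS /=; nia.
Qed.

End BinomialSums.

Section WeightedSums.
Context (R : realType) (a : nat -> R).

(** The iterated partial sums of [a], of order [p + 1]. *)
Definition binomial_average (p n : nat) : R :=
  \sum_(i < n.+1) a i * ('C(n - i + p, p))%:R.

Lemma binomial_average0 n : binomial_average 0 n = \sum_(i < n.+1) a i.
Proof. by apply: eq_bigr => i _; rewrite bin0 mulr1. Qed.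

Lemma binomial_averageS0 p : binomial_average p.+1 0 = binomial_average p 0.
Proof. by rewrite /binomial_average !big_ord_recr !big_ord0/= !binn. Qed.

Lemma binomial_averageSS p n : binomial_average p.+1 n.+1 =
  binomial_average p.+1 n + binomial_average p n.+1.
Proof.
rewrite /binomial_average big_ord_recr/= [X in _ = _ + X]big_ord_recr/= addrA -big_split/=.
rewrite subnn !add0n !binn; congr (_ + _); apply: eq_bigr => i _.
rewrite -mulrDr -natrD subSn -1?ltnS//.
by rewrite binS_shift.
Qed.

(** Summation by parts is here Pascal's rule. The binomials ['C(n + p, p)] replace
    the powers [n ^ p / p!] because they are reproduced exactly by partial sums,
    so that an additive error in the hypothesis remains a mere shift of [n]. *)
Lemma binomial_average_le (alpha : R) (C : nat) : 0 <= alpha ->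
  (forall n, \sum_(i < n.+1) a i <= alpha * (n.+1 + C)%:R) ->
  forall p n, binomial_average p n <= alpha * ('C(n + C + p.+1, p.+1))%:R.
Proof.
move=> alpha0 ha; elim=> [|p IHp] n.
  by rewrite binomial_average0 addn1 bin1 (le_trans (ha n)).
elim: n => [|n IHn].
  rewrite binomial_averageS0; apply: (le_trans (IHp 0%N)).
  by rewrite ler_wpM2l// ler_nat add0n (addnS C p.+1) binS leq_addl.
rewrite binomial_averageSS; apply: (le_trans (lerD IHn (IHp n.+1))).
by rewrite -mulrDr -natrD [X in _ <= _ * (X%:R)]binS_shift.
Qed.

Lemma binomial_average_ge (beta : R) (C : nat) : 0 <= beta ->
  (forall i, 0 <= a i) ->
  (forall n, beta * n.+1%:R <= \sum_(i < (n + C).+1) a i) ->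
  forall p n, beta * ('C(n + p.+1, p.+1))%:R <= binomial_average p (n + C).
Proof.
move=> beta0 a0 ha; elim=> [|p IHp] n.
  by rewrite binomial_average0 addn1 bin1.
have W0 k : 0 <= binomial_average p.+1 k.
  by apply: sumr_ge0 => i _; rewrite mulr_ge0.
elim: n => [|n IHn].
  have := IHp 0%N; rewrite !add0n !binn => /le_trans; apply.
  case: C {ha IHp} => [|C]; first by rewrite binomial_averageS0.
  by rewrite binomial_averageSS lerDr.
by rewrite addSn binomial_averageSS binS_shift natrD mulrDr lerD.
Qed.

End WeightedSums.

Section Envelope.
Context (R : realType) (kappa : R).
Hypothesis kappa0 : 0 <= kappa.

(** The sum of [expR (kappa * |u| - S u)] over the words [u] of length [p], where
    [S u] is the birth time of [u] and [|u|] the sum of its letters. *)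
Fixpoint envelope (p : nat) (x : tree R) : \bar R :=
  if p is p'.+1 then
    (\sum_(0 <= i <oo) (expR (kappa * i%:R - x [::] i))%:E * envelope p' (subtree i x))%E
  else 1%E.

Lemma envelope_ge0 p x : (0 <= envelope p x)%E.
Proof.
elim: p x => [|p IH] x //=; apply: nneseries_ge0 => i _ _.
by rewrite mule_ge0// lee_fin expR_ge0.
Qed.

Lemma measurable_envelope p : measurable_fun setT (envelope p).
Proof.
elim: p => [|p IH] /=; first exact: measurable_cst.
apply: ge0_emeasurable_sum => [i w _ _|i _].
  by rewrite mule_ge0 ?envelope_ge0// lee_fin expR_ge0.
apply: emeasurable_funM.
  apply: measurable_fun_EFin; apply: measurableT_comp => //.
  by apply: measurable_funB => //; exact: measurable_offspring.
exact: (measurableT_comp IH (measurable_subtree i)).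
Qed.

(** A word born before [s <= r] contributes at least [expR (- r)] to the envelope.
    The offset [r] is what makes this statement, and the next one, inductive: a
    displacement changes it by [kappa * i - x [::] i]. *)
Lemma gcount_le_envelope0 p r s x : s <= r ->
  (gcount p s x <= (expR r)%:E * envelope p x)%E.
Proof.
elim: p r s x => [|p IH] r s x sr /=.
  rewrite mule1 lee_fin; have [s0|_] := leP 0 s; last exact: expR_ge0.
  by rewrite -expR0 ler_expR (le_trans s0).
rewrite -nneseriesZl; last first.
  by move=> i _; rewrite mule_ge0 ?envelope_ge0// lee_fin expR_ge0.
apply: lee_nneseries => [i _ _|i _]; first exact: gcount_ge0.
rewrite muleA -EFinM -expRD; apply: IH.
have : 0 <= kappa * i%:R by rewrite mulr_ge0.
by lra.
Qed.

(** A word [u] born before [s] either has [|u| <= n], and there are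
    ['C(n + p, p)] such words, or contributes at least [expR (- r)] to the
    envelope. *)
Lemma gcount_le_envelope p n r s x : s <= r + kappa * n%:R ->
  (gcount p s x <= (expR r)%:E * envelope p x + ('C(n + p, p))%:R%:E)%E.
Proof.
elim: p n r s x => [|p IH] n r s x sr /=.
  rewrite bin0 mule1 -EFinD lee_fin; have [s0|_] := leP 0 s; last first.
    by rewrite addr_ge0 ?expR_ge0.
  by rewrite lerDr expR_ge0.
have e0 i : (0 <= (expR (kappa * i%:R - x [::] i))%:E * envelope p (subtree i x))%E.
  by rewrite mule_ge0 ?envelope_ge0// lee_fin expR_ge0.
rewrite -nneseriesZl; last by [].
pose c i : \bar R := if (i < n.+1)%N then ('C(n - i + p, p))%:R%:E else 0%E.
have c0 i : (0 <= c i)%E by rewrite /c; case: ifP.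
have -> : (('C(n + p.+1, p.+1))%:R%:E = \sum_(0 <= i <oo) c i)%E.
  rewrite (@nneseries_finite_support _ _ n.+1)//; last first.
    by move=> i ni; rewrite /c ltnNge ni.
  rewrite -hockey_stick natr_sum -sumEFin; apply: eq_bigr => i _.
  by rewrite /c ltn_ord.
rewrite -nneseriesD//; last by move=> i _ _; rewrite mule_ge0// lee_fin expR_ge0.
apply: lee_nneseries => [i _ _|i _]; first exact: gcount_ge0.
rewrite muleA -EFinM -expRD /c; case: ltnP => ni.
  apply: IH; rewrite ltnS in ni; rewrite natrB//; nra.
rewrite adde0; apply: gcount_le_envelope0.
have : kappa * n%:R <= kappa * i%:R by rewrite ler_wpM2l// ler_nat ltnW.
by lra.
Qed.

End Envelope.

(** * Growth of the generations of a random tree *)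

Section RandomTree.
Context (d : measure_display) (Omega : measurableType d) (R : realType)
  (P : probability Omega R) (T : seq nat -> Omega -> sequence_space R)
  (Y : Omega -> sequence_space R).
Hypothesis hT : independent_copies P T Y.
Hypothesis mY : measurable_fun setT Y.
Variable m : R.
Hypothesis m0 : 0 < m.
Hypothesis Ynonneg : {ae P, forall w, nonneg_sequence (Y w)}.
Hypothesis Ylower : forall mu, 0 < mu -> mu < m ->
  {ae P, forall w, linear_lower mu (Y w)}.
Hypothesis Ylate : forall mu delta, m < mu -> 0 < delta ->
  {ae P, forall w, rarely_late mu delta (Y w)}.
Hypothesis Ylaplace : exists phi : R, [/\ 0 <= phi, phi < 1 &
  forall i, (\int[P]_w (expR (- Y w i))%:E <= (phi ^+ i)%:E)%E].

Let X (w : Omega) : tree R := fun u => T u w.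

Let mT u : measurable_fun setT (T u).
Proof. by case: hT => h _ _; exact: h. Qed.

Let TY u : same_law P (T u) Y.
Proof. by case: hT => _ _ h; exact: h. Qed.

Let mX : measurable_fun setT X.
Proof. exact: (measurable_subprocess hT id). Qed.

Let msubX i : measurable_fun setT (fun w => subtree i (X w)).
Proof. exact: (measurable_subprocess hT (cons i)). Qed.

Let cons_inj i : injective (@cons nat i). Proof. by move=> u v []. Qed.

Let subtree_law i : same_law P (fun w => subtree i (X w)) X.
Proof.
exact: (subprocess_same_law hT (@cons_inj i) (@inj_id _)).
Qed.

Let subtree_indep i j : i <> j ->
  indep P (fun w => subtree i (X w)) (fun w => subtree j (X w)).
Proof.
by move=> ij; apply: (subprocess_indep hT (@cons_inj i) (@cons_inj j)) => u v [].
Qed.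

Let root_subtree_indep i : indep P
  (fun w => (fun _ : unit => T [::] w) : process_space unit (sequence_space R))
  (fun w => subtree i (X w)).
Proof.
have rootI : injective (fun _ : unit => [::] : seq nat) by move=> [] [].
exact: (subprocess_indep hT rootI (@cons_inj i)).
Qed.

Let ae_offspring (A : set (sequence_space R)) u : measurable A ->
  {ae P, forall w, A (Y w)} -> {ae P, forall w, A (T u w)}.
Proof.
move=> mA; apply: same_law_ae => //.
by move=> B mB; rewrite TY.
Qed.

Lemma random_tree_nonneg : {ae P, forall w, nonneg_tree (X w)}.
Proof.
have h : {ae P, forall w (n : nat),
    nonneg_sequence (T (odflt [::] (choice.unpickle n)) w)}.
  apply: ae_foralln => n; apply: ae_offspring => //.
  exact: measurable_nonneg_sequence.
apply: filterS h => w h u.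
by have := h (choice.pickle u); rewrite choice.pickleK.
Qed.

(** By independence of the root and its subtrees, each generation multiplies the
    mean of the envelope by at most the sum of the series of ratio
    [expR kappa * phi], which converges for small [kappa]. *)
Lemma envelope_integrable : exists2 kappa : R, 0 < kappa &
  forall p, (\int[P]_w envelope kappa p (X w) < +oo)%E.
Proof.
have [phi [phi0 phi1 hphi]] := Ylaplace.
have [rho rho1 rhophi] : exists2 rho, 1 < rho & rho * phi < 1.
  exists (2 / (1 + phi)); first by rewrite ltr_pdivlMr; lra.
  by rewrite mulrAC ltr_pdivrMr; lra.
have rho0 : 0 < rho by lra.
exists (ln rho); first by rewrite ln_gt0.
have k0 : 0 <= ln rho by rewrite ltW// ln_gt0.
have e0 p x : (0 <= envelope (ln rho) p x)%E by exact: envelope_ge0.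
elim=> [|p IH] /=.
  by rewrite integral_cst//= probability_setT mule1 ltry.
set I := (\int[P]_w envelope (ln rho) p (X w))%E in IH.
have I0 : (0 <= I)%E by exact: integral_ge0.
pose f i (x : process_space unit (sequence_space R)) :=
  (expR (ln rho * i%:R - x tt i))%:E.
have f0 i x : (0 <= f i x)%E by rewrite lee_fin expR_ge0.
have mf i : measurable_fun setT (f i).
  apply: measurable_fun_EFin; apply: measurableT_comp => //.
  apply: measurable_funB => //.
  exact: (measurableT_comp (measurable_sequence_coord i)
    (@measurable_coord _ _ (sequence_space R) tt)).
have mroot : measurable_fun setT
    (fun w => (fun _ : unit => T [::] w) : process_space unit (sequence_space R)).
  exact: (measurable_subprocess hT (fun _ : unit => [::])).
have menv : measurable_fun setT (envelope (R := R) (ln rho) p).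
  exact: measurable_envelope.
have step i : (\int[P]_w (f i (fun=> T [::] w) * envelope (ln rho) p (subtree i (X w)))
    <= ((rho * phi) ^+ i)%:E * I)%E.
  rewrite (integral_indep mroot (msubX i) (root_subtree_indep i))//.
  rewrite (same_law_integral (msubX i) mX (subtree_law i) menv)//.
  apply: lee_wpmul2r => //.
  have -> : (\int[P]_w f i (fun=> T [::] w) =
      \int[P]_w ((rho ^+ i)%:E * (expR (- T [::] w i))%:E))%E.
    apply: eq_integral => w _; rewrite /f expRD EFinM; congr (_%:E * _)%E.
    by rewrite mulrC expRM_natl lnK.
  have mexp : measurable_fun setT (fun t : sequence_space R => (expR (- t i))%:E).
    apply: measurable_fun_EFin; apply: measurableT_comp => //.
    by apply: measurableT_comp => //; exact: measurable_sequence_coord.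
  have exp0 (t : sequence_space R) : (0 <= (expR (- t i))%:E)%E.
    by rewrite lee_fin expR_ge0.
  rewrite ge0_integralZl//; last 2 first.
  - exact: (measurableT_comp mexp (mT [::])).
  - by rewrite lee_fin exprn_ge0// ltW.
  rewrite exprMn EFinM lee_wpmul2l ?lee_fin ?exprn_ge0 ?(ltW rho0)//.
  by rewrite (same_law_integral (mT [::]) mY (@TY [::]) mexp exp0).
rewrite integral_nneseries//; last 2 first.
- move=> i; apply: emeasurable_funM; last exact: (measurableT_comp menv (msubX i)).
  exact: (measurableT_comp (mf i) mroot).
- by move=> i w _; rewrite mule_ge0// lee_fin expR_ge0.
apply: (@le_lt_trans _ _ (\sum_(0 <= i <oo) ((rho * phi) ^+ i)%:E * I)%E).
  apply: lee_nneseries => [i _ _|i _]; last exact: step.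
  by apply: integral_ge0 => w _; rewrite mule_ge0// lee_fin expR_ge0.
have -> : I = (fine I)%:E by rewrite fineK// ge0_fin_numE.
under eq_eseriesr do rewrite muleC.
have rp0 : 0 <= rho * phi by rewrite mulr_ge0// ltW.
rewrite nneseriesZl; last by move=> i _; rewrite lee_fin exprn_ge0.
by apply: lte_mul_pinfty; rewrite ?lee_fin ?fine_ge0// nneseries_geometric_fin.
Qed.

(** Time is counted in units [mu] and the growth compared with ['C(n + p, p)], for
    which the induction on [p] is exact. *)
Definition upper_at (p : nat) (mu alpha : R) (K : nat) : set (tree R) :=
  [set x | forall n : nat,
     (gcount p (mu * n%:R) x <= (alpha * ('C(n + K + p, p))%:R)%:E)%E].

Lemma measurable_upper_at p mu alpha K : measurable (upper_at p mu alpha K).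
Proof.
apply: measurable_forall_nat => n; apply: measurable_lee_fun => //.
exact: measurable_gcount.
Qed.

Lemma upper_at_nondecreasing p mu alpha K L : 0 <= alpha -> (K <= L)%N ->
  upper_at p mu alpha K `<=` upper_at p mu alpha L.
Proof.
move=> alpha0 KL x h n; apply: (le_trans (h n)).
by rewrite lee_fin ler_wpM2l// ler_nat leq_bin2l// leq_add2r leq_add2l.
Qed.

(** Let [Z] bound the ratio of the count of generation [p] to ['C(n + K + p, p)]
    uniformly in [n]: it is [beta] outside an event of small probability, where
    the envelope takes over. Hence its mean is below [alpha] for large [K], and
    the strong law controls the sums of its copies attached to the children of
    the root. Since the child [i] is born after time [mu * (i - i0)], generation
    [p + 1] is bounded by a binomial average of these copies. *)
Lemma upper_bound p mu alpha : 0 < mu -> mu < m -> 1 < alpha ->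
  {ae P, forall w, exists K, upper_at p mu alpha K (X w)}.
Proof.
move=> mu0 mum; elim: p alpha => [|p IH] alpha alpha1.
  apply: aeW => w; exists 0%N => n /=; rewrite bin0 mulr1 lee_fin.
  by case: (0 <= mu * n%:R) => /=; lra.
pose beta := (1 + alpha) / 2.
have beta1 : 1 < beta by rewrite /beta; lra.
have ba : beta < alpha by rewrite /beta; lra.
have [kappa kappa0 envfin] := envelope_integrable.
(* the envelope works in units [kappa]; [c] converts them into units [mu] *)
pose c := (Num.truncn (mu / kappa)).+1.
have muc : mu <= kappa * c%:R.
  by rewrite mulrC -ler_pdivrMr//; exact/ltW/truncnS_gt.
pose M (x : tree R) := (envelope kappa p x + ((c ^ p)%:R : R)%:E)%E.
have M0 x : (0 <= M x)%E by rewrite adde_ge0 ?envelope_ge0// lee_fin.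
have mM : measurable_fun setT M.
  by apply: emeasurable_funD => //; exact: measurable_envelope.
have gM n x : (gcount p (mu * n%:R) x <= M x * ('C(n + p, p))%:R%:E)%E.
  have h : mu * n%:R <= 0 + kappa * (c * n)%N%:R.
    by rewrite add0r natrM mulrA ler_wpM2r.
  apply: (le_trans (gcount_le_envelope (ltW kappa0) p x h)).
  rewrite expR0 mul1e /M ge0_muleDl ?envelope_ge0 ?lee_fin//.
  apply: leeD.
    rewrite -{1}[envelope _ _ _]mule1 lee_wpmul2l ?envelope_ge0// lee_fin ler1n.
    by rewrite bin_gt0 leq_addl.
  by rewrite -EFinM lee_fin -natrM ler_nat bin_dilate.
have intM : (\int[P]_w M (X w) < +oo)%E.
  rewrite ge0_integralD//.
  - by rewrite integral_cst//= probability_setT mule1 lte_add_pinfty ?ltry.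
  - by move=> w _; exact: envelope_ge0.
  - exact: (measurableT_comp (measurable_envelope kappa p) mX).
have beta0 : 0 <= beta by lra.
pose U K := upper_at p mu beta K.
have mU K : measurable (U K) by exact: measurable_upper_at.
have mMX : measurable_fun setT (fun w => M (X w)) by exact: measurableT_comp.
have [K hK] : exists K, (\int[P]_(w in ~` (X @^-1` U K)) M (X w) < (alpha - beta)%:E)%E.
  apply: (@integral_small_tail _ _ _ P (fun w => M (X w)) (fun K => X @^-1` U K)) => //.
  - by move=> K; exact: measurable_preimage.
  - by move=> K L KL w; exact: upper_at_nondecreasing.
  - exact: IH.
  - by rewrite subr_gt0.
pose Z (x : tree R) := (beta%:E + M x * (\1_(~` U K) x)%:E)%E.
have mMI : measurable_fun setT (fun x => (M x * (\1_(~` U K) x)%:E)%E).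
  apply: emeasurable_funM => //; apply: measurable_fun_EFin.
  by apply: measurable_indic; exact: measurableC.
have MI0 x : (0 <= M x * (\1_(~` U K) x)%:E)%E by rewrite mule_ge0// lee_fin.
have Z0 x : (0 <= Z x)%E by rewrite adde_ge0// lee_fin.
have mZ : measurable_fun setT Z by exact: emeasurable_funD.
have intZ : (\int[P]_w Z (X w) < alpha%:E)%E.
  rewrite ge0_integralD//; last exact: (measurableT_comp mMI mX).
  rewrite integral_cst//= probability_setT mule1.
  rewrite [X in (_ + X)%E](_ : _ = (\int[P]_(w in ~` (X @^-1` U K)) M (X w))%E); last first.
    rewrite [RHS]integral_mkcond; apply: eq_integral => w _.
    rewrite patchE indicE; have [h|h] := boolP (w \in _).
      by rewrite mem_set ?mule1//; move: h => /set_mem.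
    rewrite memNset ?mule0// => h'; move/negP: h; apply; exact/mem_set.
  by rewrite -(subrK beta alpha) EFinD addeC lteD2rE.
have gZ n x : (gcount p (mu * n%:R) x <= Z x * ('C(n + K + p, p))%:R%:E)%E.
  have C0 : (0 <= ('C(n + K + p, p))%:R%:E :> \bar R)%E by rewrite lee_fin.
  have [h|h] := pselect (U K x).
    apply: (le_trans (h n)); rewrite EFinM lee_wpmul2r// /Z leeDl//.
  apply: (le_trans (gM n x)).
  apply: (@le_trans _ _ (M x * ('C(n + K + p, p))%:R%:E)%E).
    rewrite lee_wpmul2l// lee_fin ler_nat leq_bin2l// leq_add2r leq_addr//.
  rewrite lee_wpmul2r// /Z indicE mem_set// mule1 leeDr// lee_fin//.
have SL := strong_law_upper msubX mX subtree_indep subtree_law mZ Z0 intZ.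
have LL := ae_offspring [::] (measurable_linear_lower mu) (Ylower mu0 mum).
apply: filterS3 SL LL random_tree_nonneg => w [C hC] [i0 hi0] Xnn.
exists (i0 + K + C)%N => n.
have Zfin i : Z (subtree i (X w)) \is a fin_num.
  rewrite ge0_fin_numE//; apply: (@le_lt_trans _ _ (\sum_(k < i.+1) Z (subtree k (X w)))%E).
    by rewrite big_ord_recr/= leeDr// sume_ge0.
  by apply: (le_lt_trans (hC i.+1)); rewrite ltry.
pose a i := fine (Z (subtree i (X w))).
have aE i : Z (subtree i (X w)) = (a i)%:E by rewrite /a fineK.
have a0 i : 0 <= a i by exact: fine_ge0.
have asum k : \sum_(i < k.+1) a i <= alpha * (k.+1 + C)%:R.
  rewrite -lee_fin -sumEFin; under eq_bigr do rewrite -aE.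
  exact: hC.
have alpha0 : 0 <= alpha by lra.
have := binomial_average_le alpha0 asum p (n + i0 + K).
rewrite (_ : n + (i0 + K + C) = n + i0 + K + C)%N; last by rewrite !addnA.
rewrite -lee_fin; apply: le_trans.
(* later children are born after time [mu * n] *)
rewrite /= (@nneseries_finite_support _ _ (n + i0).+1); last 2 first.
- by move=> i; exact: gcount_ge0.
- move=> i ni; apply: gcount_neg; first exact: nonneg_subtree.
  have h := hi0 i.
  have h2 : (n + i0 + 1)%N%:R <= i%:R :> R by rewrite ler_nat addn1.
  rewrite !natrD in h2; rewrite /X; nra.
rewrite /binomial_average -sumEFin.
rewrite -(big_mkord xpredT (fun i =>
  gcount p (mu * n%:R - X w [::] i) (subtree i (X w)))).
rewrite -(big_mkord xpredT (fun i => (a i * ('C(n + i0 + K - i + p, p))%:R)%:E)).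
rewrite [leRHS](@big_cat_nat _ _ _ (n + i0).+1)//=; last by rewrite ltnS leq_addr.
rewrite -[leLHS]adde0; apply: leeD; last first.
  by apply: sume_ge0 => i _; rewrite lee_fin mulr_ge0.
rewrite !big_nat; apply: lee_sum => i /andP[_ ni]; rewrite ltnS in ni.
rewrite EFinM -aE (_ : n + i0 + K - i = n + i0 - i + K)%N; last by rewrite addnBAC.
apply: le_trans (gZ _ _); apply: le_gcount.
rewrite natrB// natrD; have := hi0 i; rewrite /X; lra.
Qed.

Definition lower_at (p : nat) (mu alpha : R) (K : nat) : set (tree R) :=
  [set x | forall n : nat,
     ((alpha * ('C(n + p, p))%:R)%:E <= gcount p (mu * (n + K)%:R) x)%E].

Lemma measurable_lower_at p mu alpha K : measurable (lower_at p mu alpha K).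
Proof.
apply: measurable_forall_nat => n; apply: measurable_lee_fun => //.
exact: measurable_gcount.
Qed.

Lemma lower_at_nondecreasing p mu alpha K L : 0 <= mu -> (K <= L)%N ->
  lower_at p mu alpha K `<=` lower_at p mu alpha L.
Proof.
move=> mu0 KL x h n; apply: (le_trans (h n)).
by apply: le_gcount; rewrite ler_wpM2l// ler_nat leq_add2l.
Qed.

(** A child [i] is good if its own progeny is already large, in the sense of
    [lower_at] with a common [K], and if it is not late. Each condition fails with
    small frequency, so that the good children, each born before [mu * i], have
    frequency at least [beta], and generation [p + 1] is bounded below by
    [beta] times their binomial average. *)
Lemma lower_bound p mu alpha : m < mu -> 0 < alpha -> alpha < 1 ->
  {ae P, forall w, exists K, lower_at p mu alpha K (X w)}.
Proof.
move=> mmu; have mu0 : 0 < mu by exact: lt_trans mmu.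
elim: p alpha => [|p IH] alpha alpha0 alpha1.
  apply: aeW => w; exists 0%N => n /=; rewrite bin0 mulr1 lee_fin.
  by rewrite mulr_ge0 ?(ltW mu0)//= ltW.
pose beta := (1 + alpha) / 2.
have beta_half : 1 / 2 < beta by rewrite /beta; lra.
have beta1 : beta < 1 by rewrite /beta; lra.
have beta0 : 0 < beta by lra.
have betabeta : alpha <= beta * beta.
  by rewrite /beta; have := sqr_ge0 (1 - alpha); rewrite expr2; lra.
pose delta := (1 - beta) / 2.
have delta0 : 0 < delta by rewrite /delta; lra.
pose L K := lower_at p mu beta K.
have mL K : measurable (L K) by exact: measurable_lower_at.
have [K hK] : exists K, (\int[P]_(w in ~` (X @^-1` L K)) (cst 1%E w) < delta%:E)%E.
  apply: (@integral_small_tail _ _ _ P (cst 1%E) (fun K => X @^-1` L K)) => //.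
  - by rewrite integral_cst//= probability_setT mule1 ltry.
  - by move=> K; exact: measurable_preimage.
  - by move=> K K' KK' w; apply: lower_at_nondecreasing => //; exact: ltW.
  - exact: IH.
pose bad (x : tree R) : \bar R := (\1_(~` L K) x)%:E.
have mbad : measurable_fun setT bad.
  apply: measurable_fun_EFin.
  by apply: measurable_indic; exact: measurableC.
have bad0 x : (0 <= bad x)%E by rewrite lee_fin.
have intbad : (\int[P]_w bad (X w) < delta%:E)%E.
  apply: le_lt_trans hK; rewrite [leRHS]integral_mkcond.
  rewrite le_eqVlt; apply/orP; left; apply/eqP; apply: eq_integral => w _.
  rewrite patchE /bad indicE; have [h|h] := boolP (w \in _).
    by rewrite mem_set//; move: h => /set_mem.
  rewrite memNset// => h'; move/negP: h; apply; exact/mem_set.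
have SL := strong_law_upper msubX mX subtree_indep subtree_law mbad bad0 intbad.
have LL := ae_offspring [::] (measurable_rarely_late mu delta) (Ylate mmu delta0).
apply: filterS2 SL LL => w [C1 hC1] [C2 hC2].
pose good i := (subtree i (X w) \in L K) && (T [::] w i <= mu * i%:R).
pose a i : R := (good i)%:R.
have a0 i : 0 <= a i by [].
have alow i : 1 - \1_(~` L K) (subtree i (X w)) - \1_(late_indices mu i) (T [::] w) <= a i.
  rewrite /a /good !indicE in_setC.
  have -> : (T [::] w \in late_indices mu i) = (mu * i%:R < T [::] w i).
    by apply/idP/idP => [/set_mem//|h]; exact/mem_set.
  by rewrite ltNge; case: (_ \in L K); case: (T [::] w i <= mu * i%:R) => /=; lra.
pose C := (C1 + C2)%N.
have asum n : beta * n.+1%:R <= \sum_(i < (n + C).+1) a i.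
  apply: (@le_trans _ _ (\sum_(i < (n + C).+1) (1 - \1_(~` L K) (subtree i (X w)) -
      \1_(late_indices mu i) (T [::] w)))); last by apply: ler_sum => i _; exact: alow.
  rewrite !sumrB sumr_const card_ord.
  have h1 : \sum_(i < (n + C).+1) (\1_(~` L K) (subtree i (X w)) : R) <=
      delta * ((n + C).+1 + C1)%:R.
    by rewrite -lee_fin -sumEFin; exact: hC1.
  have h2 := hC2 (n + C).+1.
  move: h1 h2.
  move: (\sum_(i < _) \1_(~` L K) _) (\sum_(i < _) \1_(late_indices _ _) _) => s1 s2.
  have CC : C%:R = C1%:R + C2%:R :> R by rewrite /C natrD.
  have C0 : 0 <= C%:R :> R by [].
  rewrite !natrD -!natr1 !natrD /delta => h1 h2.
  have h3 : 0 <= (beta - 1 / 2) * C%:R by rewrite mulr_ge0// ltW// subr_gt0.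
  have h4 : 0 <= (1 - beta) * C%:R by rewrite mulr_ge0// subr_ge0 ltW.
  nra.
exists (C + K)%N => n.
have := binomial_average_ge (ltW beta0) a0 asum p n => h.
apply: (@le_trans _ _ ((beta * binomial_average a p (n + C))%:E)).
  rewrite lee_fin; apply: (le_trans (ler_wpM2r _ betabeta)) => //.
  by rewrite -mulrA ler_wpM2l// ltW.
rewrite /= /binomial_average mulr_sumr -sumEFin.
apply: (@le_trans _ _ (\sum_(i < (n + C).+1)
    gcount p (mu * (n + (C + K))%:R - X w [::] i) (subtree i (X w)))%E); last first.
  rewrite -(big_mkord xpredT (fun i =>
    gcount p (mu * (n + (C + K))%:R - X w [::] i) (subtree i (X w)))).
  by apply: nneseries_lim_ge => i _ _; exact: gcount_ge0.
apply: lee_sum => i _; rewrite /a; have [|_] := boolP (good i); last first.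
  by rewrite mul0r mulr0 gcount_ge0.
move=> /andP[/set_mem Li Ti]; rewrite mul1r.
apply: (le_trans (Li _)); apply: le_gcount.
have iC : (i <= n + C)%N by rewrite -ltnS.
rewrite addnA !natrD natrB// natrD /X.
have CC : C%:R = C1%:R + C2%:R :> R by rewrite /C natrD.
by move: Ti; rewrite CC; lra.
Qed.

End RandomTree.

(** * From binomial bounds to the limit *)

Section PolynomialGrowth.
Context (R : realType).

Lemma bin_fact_ge j n : (n.+1 ^ j <= 'C(n + j, j) * j`!)%N.
Proof.
elim: j => [|j IH]; first by rewrite bin0 expn0 fact0.
rewrite factS mulnCA mulnA addnS -mul_bin_diag /= -mulnA expnS.
by apply: leq_mul => //; rewrite ltnS leq_addr.
Qed.

Lemma bin_fact_le j n : ('C(n + j, j) * j`! <= (n + j) ^ j)%N.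
Proof.
elim: j => [|j IH]; first by rewrite bin0 expn0 fact0.
rewrite factS mulnCA mulnA addnS -mul_bin_diag /= -mulnA expnS.
apply: leq_mul => //; apply: (leq_trans IH).
by rewrite -addnS; case: j {IH} => // i; rewrite leq_exp2r// leq_add2l.
Qed.

Variables (N : R -> \bar R) (j : nat) (m : R) (r : nat -> R).
Hypothesis m0 : 0 < m.
Hypothesis N_nd : forall s t, s <= t -> (N s <= N t)%E.
Hypothesis r0 : forall k, 0 < r k.
Hypothesis r1 : forall k, r k < 1.
Hypothesis r_cvg : r @ \oo --> (0 : R).
Hypothesis N_upper : forall k, exists K : nat, forall n : nat,
  (N (m * (1 - r k) * n%:R) <= ((1 + r k) * ('C(n + K + j, j))%:R)%:E)%E.
Hypothesis N_lower : forall k, exists K : nat, forall n : nat,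
  (((1 - r k) * ('C(n + j, j))%:R)%:E <= N (m * (1 + r k) * (n + K)%:R))%E.

Let c := (m ^+ j * j`!%:R)^-1.

Let fact0 : 0 < j`!%:R :> R. Proof. by rewrite ltr0n fact_gt0. Qed.

Let c0 : 0 < c. Proof. by rewrite invr_gt0 mulr_gt0// exprn_gt0. Qed.

Let upper_const (x : R) := c * ((1 + x) ^+ j.+1 / (1 - x) ^+ j).
Let lower_const (x : R) := c * ((1 - x) ^+ j.+1 / (1 + x) ^+ j).

(** Between two multiples of [m * (1 - r k)] monotonicity loses at most one unit of
    time, which, like the shift [K], is a fraction [r k] of [t] for large [t]. *)
Lemma eventually_le k :
  \forall t \near +oo, (N t <= (upper_const (r k) * t ^+ j)%:E)%E.
Proof.
have [K hK] := N_upper k.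
set x := r k in hK *; have x0 : 0 < x := r0 k; have x1 : x < 1 := r1 k.
pose mu := m * (1 - x).
have mu0 : 0 < mu by rewrite mulr_gt0// subr_gt0.
near=> t.
have t0 : 0 <= t by near: t; apply: nbhs_pinfty_ge; rewrite num_real.
have tK : mu * (K + j).+1%:R / x <= t by near: t; apply: nbhs_pinfty_ge; rewrite num_real.
pose n := (Num.truncn (t / mu)).+1.
have tn : t <= mu * n%:R by rewrite mulrC -ler_pdivrMr//; exact/ltW/truncnS_gt.
apply: (le_trans (N_nd tn)); apply: (le_trans (hK n)); rewrite lee_fin.
have nt : n%:R <= t / mu + 1.
  by rewrite /n -natr1 lerD2r truncn_le divr_ge0// ltW.
have h1 : ('C(n + K + j, j))%:R <= (n + K + j)%:R ^+ j / j`!%:R :> R.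
  rewrite ler_pdivlMr// -natrM -natrX ler_nat; exact: bin_fact_le.
have h2 : (n + K + j)%:R <= (1 + x) * (t / mu).
  have : t / mu * x >= (K + j).+1%:R.
    rewrite mulrAC ler_pdivlMr//; move: tK; rewrite ler_pdivrMr//.
    by rewrite mulrC.
  by rewrite -natr1 !natrD; move: nt; lra.
apply: (@le_trans _ _ ((1 + x) * (((1 + x) * (t / mu)) ^+ j / j`!%:R))).
  rewrite ler_wpM2l//; first by lra.
  apply: (le_trans h1); rewrite ler_wpM2r ?invr_ge0 ?(ltW fact0)//.
  by apply: lerXn2r => //; rewrite nnegrE ?ler0n// (le_trans _ h2).
rewrite le_eqVlt; apply/orP; left; apply/eqP.
rewrite /upper_const /c /mu ?exprMn ?exprVn ?exprMn exprS.
field; rewrite !expf_neq0 ?gt_eqF//=; lra.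
Unshelve. all: by end_near.
Qed.

Lemma eventually_ge k :
  \forall t \near +oo, ((lower_const (r k) * t ^+ j)%:E <= N t)%E.
Proof.
have [K hK] := N_lower k.
set x := r k in hK *; have x0 : 0 < x := r0 k; have x1 : x < 1 := r1 k.
pose mu := m * (1 + x).
have mu0 : 0 < mu by rewrite mulr_gt0//; lra.
near=> t.
have t0 : 0 <= t by near: t; apply: nbhs_pinfty_ge; rewrite num_real.
have tK : mu * K%:R <= t by near: t; apply: nbhs_pinfty_ge; rewrite num_real.
have tKx : mu * K%:R / x <= t by near: t; apply: nbhs_pinfty_ge; rewrite num_real.
pose n := (Num.truncn (t / mu) - K)%N.
have Kt : (K <= Num.truncn (t / mu))%N.
  by rewrite truncn_ge_nat ?divr_ge0 ?(ltW mu0)// ler_pdivlMr// mulrC.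
have tn : mu * (n + K)%:R <= t.
  by rewrite subnK// mulrC -ler_pdivlMr// truncn_le divr_ge0// ltW.
apply: le_trans (N_nd tn); apply: le_trans (hK n); rewrite lee_fin.
have nt : t / mu - K%:R <= n.+1%:R.
  by rewrite -natr1 natrB// addrAC natr1 lerD2r ltW// truncnS_gt.
have h1 : n.+1%:R ^+ j / j`!%:R <= ('C(n + j, j))%:R :> R.
  rewrite ler_pdivrMr// -natrM -natrX ler_nat; exact: bin_fact_ge.
have h2 : (1 - x) * (t / mu) <= n.+1%:R.
  have : t / mu * x >= K%:R.
    rewrite mulrAC ler_pdivlMr//; move: tKx; rewrite ler_pdivrMr//.
    by rewrite mulrC.
  by move: nt; lra.
apply: (@le_trans _ _ ((1 - x) * (((1 - x) * (t / mu)) ^+ j / j`!%:R))); last first.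
  rewrite ler_wpM2l//; first by lra.
  apply: le_trans h1; rewrite ler_wpM2r ?invr_ge0 ?(ltW fact0)//.
  apply: lerXn2r => //; rewrite nnegrE ?ler0n//.
  by rewrite mulr_ge0 ?divr_ge0 ?(ltW mu0)// subr_ge0 ltW.
rewrite le_eqVlt; apply/orP; left; apply/eqP.
rewrite /lower_const /c /mu ?exprMn ?exprVn ?exprMn exprS.
field; rewrite !expf_neq0 ?gt_eqF//=; lra.
Unshelve. all: by end_near.
Qed.

Let upper_const_cvg : (upper_const \o r) @ \oo --> c.
Proof.
have e : c * ((1 + 0) ^+ j.+1 / (1 - 0) ^+ j) = c.
  by rewrite addr0 subr0 !expr1n divr1 mulr1.
rewrite -[X in _ --> X]e.
apply: cvgM; first exact: cvg_cst.
apply: cvgM.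
  apply: (@continuous_cvg _ _ _ _ _ _ (fun y : R => y ^+ j.+1)); first exact: exprn_continuous.
  by apply: cvgD => //; exact: cvg_cst.
apply: cvgV; first by rewrite subr0 expr1n oner_eq0.
apply: (@continuous_cvg _ _ _ _ _ _ (fun y : R => y ^+ j)); first exact: exprn_continuous.
by apply: cvgB => //; exact: cvg_cst.
Qed.

Let lower_const_cvg : (lower_const \o r) @ \oo --> c.
Proof.
have e : c * ((1 - 0) ^+ j.+1 / (1 + 0) ^+ j) = c.
  by rewrite addr0 subr0 !expr1n divr1 mulr1.
rewrite -[X in _ --> X]e.
apply: cvgM; first exact: cvg_cst.
apply: cvgM.
  apply: (@continuous_cvg _ _ _ _ _ _ (fun y : R => y ^+ j.+1)); first exact: exprn_continuous.
  by apply: cvgB => //; exact: cvg_cst.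
apply: cvgV; first by rewrite addr0 expr1n oner_eq0.
apply: (@continuous_cvg _ _ _ _ _ _ (fun y : R => y ^+ j)); first exact: exprn_continuous.
by apply: cvgD => //; exact: cvg_cst.
Qed.

(** Both constants tend to [c] with [r k]. *)
Lemma polynomial_growth : (N t / (t ^+ j)%:E)%E @[t --> +oo] --> c%:E.
Proof.
have ratio k : \forall t \near +oo, exists2 y : R,
    (N t / (t ^+ j)%:E)%E = y%:E & lower_const (r k) <= y <= upper_const (r k).
  near=> t.
  have tgt0 : 0 < t by near: t; apply: nbhs_pinfty_gt; rewrite num_real.
  have tj : 0 < t ^+ j by rewrite exprn_gt0.
  have hu : (N t <= (upper_const (r k) * t ^+ j)%:E)%E.
    by near: t; exact: eventually_le.
  have hl : ((lower_const (r k) * t ^+ j)%:E <= N t)%E.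
    by near: t; exact: eventually_ge.
  move: hu hl; case: (N t) => [y| |]//; rewrite !lee_fin => hu hl.
  exists (y / t ^+ j); first by rewrite inver gt_eqF// -EFinM.
  by rewrite ler_pdivlMr// ler_pdivrMr// hl.
apply/fine_cvgP; split.
  by apply: filterS (ratio 0%N) => t [y -> _].
apply/cvgrPdist_lt => eps eps0.
have /cvgrPdist_lt/(_ _ eps0) hu := upper_const_cvg.
have /cvgrPdist_lt/(_ _ eps0) hl := lower_const_cvg.
have [k _ /(_ k (leqnn k)) /= [hku hkl]] := filterI hu hl.
apply: filterS (ratio k) => t [y /= -> /andP[ly yu]] /=.
move: hku hkl; rewrite !ltr_norml => /andP[? ?] /andP[? ?].
by apply/andP; split; lra.
Unshelve. all: by end_near.
Qed.

End PolynomialGrowth.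

Unset Implicit Arguments.
Set Strict Implicit.
Set Printing Implicit Defensive.

Theorem theorem2p8 (R : realType) (d : measure_display)
    (Omega : measurableType d) (P : probability Omega R)
    (xi eta : {RV P >-> R})
    (xis etas : nat -> Omega -> R)
    (T : seq nat -> Omega -> sequence_space R)
    (hpos : {ae P, forall w, 0 < xi w /\ 0 < eta w})
    (hcopies : independent_copies P (fun i w => (xis i w, etas i w))
                                    (fun w => (xi w, eta w)))
    (hT : independent_copies P T (perturbed_random_walk xis etas))
    (hm : ('E_P[xi] < +oo)%E)
    (j : nat) (hj : (0 < j)%N) :
  {ae P, forall w,
    (generation_count T j t w / (t ^+ j)%:E)%E @[t --> +oo]
      --> ((fine 'E_P[xi] ^+ j * j`!%:R)^-1)%:E}.
Proof.
have mW := measurable_perturbed_random_walk hcopies.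
have m0 := mean_step_gt0 hpos hm.
have Wnonneg := perturbed_walk_nonneg hpos hcopies.
have Wlower := perturbed_walk_linear_lower hpos hcopies hm.
have Wlate := perturbed_walk_rarely_late hpos hcopies hm.
have Wlaplace := perturbed_walk_laplace hpos hcopies.
pose r (k : nat) : R := k.+2%:R^-1.
have r0 k : 0 < r k by rewrite invr_gt0.
have r1 k : r k < 1 by rewrite invf_lt1// ltr1n.
have rcvg : r @ \oo --> (0 : R).
  by have := @cvg_harmonic R; rewrite -cvg_shiftS.
have U : {ae P, forall w k, exists K,
    upper_at j (fine 'E_P[xi] * (1 - r k)) (1 + r k) K (fun u => T u w)}.
  apply: ae_foralln => k.
  apply: (upper_bound hT mW Wnonneg Wlower Wlaplace).
  - by rewrite mulr_gt0// subr_gt0.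
  - by rewrite gtr_pMr// gtrBl.
  - by rewrite ltrDl.
have L : {ae P, forall w k, exists K,
    lower_at j (fine 'E_P[xi] * (1 + r k)) (1 - r k) K (fun u => T u w)}.
  apply: ae_foralln => k.
  apply: (lower_bound hT mW m0 Wlate).
  - by rewrite ltr_pMr// ltrDl.
  - by rewrite subr_gt0.
  - by rewrite gtrBl.
apply: filterS2 U L => w U L.
under eq_fun do rewrite generation_count_gcount.
apply: (polynomial_growth m0 _ r0 r1 rcvg U L).
by move=> s t; exact: le_gcount.
Qed.
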